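(* Let $d\ge1$ and let $\rho$ be the Matérn kernel on $\mathbb{R}^d$ with variance $\sigma^2>0$, correlation length $0<\lambda\le1$ and smoothness parameter $1/2\le\nu<\infty$, and let $\ell\ge1$. Then $$0<\widehat\rho(\boldsymbol{\xi}_{\boldsymbol{k}(j)})\ \lesssim\ \lambda^{-2\nu}\,(\nu\ell^2)^{\nu+d/2}\,j^{-(1+2\nu/d)},\qquad j=1,2,\ldots,$$ where $\boldsymbol{\xi}_{\boldsymbol{k}}=\boldsymbol{k}/(2\ell)$ and $\{\boldsymbol{k}(j)\}_{j\ge1}$ is an enumeration of $\mathbb{Z}^d$ with $\boldsymbol{k}(1)=\boldsymbol{0}$ and $\|\boldsymbol{k}(j)\|_2$ non-decreasing in $j$.
   Context: Matérn kernel: $\rho(\boldsymbol{x})=\kappa(\|\boldsymbol{x}\|_2/\lambda)$ with $\kappa(r)=\sigma^2\,\frac{2^{1-\nu}}{\Gamma(\nu)}(\sqrt{2\nu}\,r)^{\nu}K_\nu(\sqrt{2\nu}\,r)$, where $\Gamma$ is the gamma function and $K_\nu$ the modified Bessel function of the second kind. Fourier transform: $\widehat\rho(\boldsymbol{\xi})=\int_{\mathbb{R}^d}\rho(\boldsymbol{x})\exp(-2\pi\mathrm{i}\,\boldsymbol{\xi}\cdot\boldsymbol{x})\,\mathrm{d}\boldsymbol{x}$. For the Matérn kernel it equals $$\widehat\rho(\boldsymbol{\xi})=\lambda^d\sigma^22^d\pi^{d/2}(2\nu)^\nu\frac{\Gamma(\nu+d/2)}{\Gamma(\nu)}\,\frac{1}{(2\nu+(2\pi\lambda\|\boldsymbol{\xi}\|_2)^2)^{\nu+d/2}}.$$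 $A\lesssim B$ means that $A/B$ is bounded above by a constant independent of $\ell,h_0,\lambda,\nu$ (and of the index $j$); the constant may depend on $d$ and $\sigma^2$. Here $h_0$ is the mesh width of the underlying sampling grid, which does not otherwise enter the estimate. *)

(* Defs.v *)
From HB Require Import structures.
From mathcomp Require Import all_boot all_order all_algebra complex.
From mathcomp Require Import all_classical all_reals all_analysis.

Set Implicit Arguments.
Unset Strict Implicit.
Unset Printing Implicit Defensive.

Import Order.TTheory GRing.Theory Num.Theory.
Import numFieldNormedType.Exports.

Local Open Scope classical_set_scope.
Local Open Scope ring_scope.
Local Open Scope complex_scope.

(* Lebesgue measure on R^n, by iterated products. Points of R^n are n-tuples,
   with the sigma-algebra generated by the coordinates. *)
Section lebesgue_tuple.
Context (R : realType).

Definition tcons n (p : measurableTypeR R * n.-tuple (measurableTypeR R)) :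
  n.+1.-tuple (measurableTypeR R) := [tuple of p.1 :: p.2].

Definition tuncons n (x : n.+1.-tuple (measurableTypeR R)) :
    measurableTypeR R * n.-tuple (measurableTypeR R) :=
  (thead x, [tuple of behead x]).

Lemma tconsK n : cancel (@tcons n) (@tuncons n).
Proof. by case=> x t; congr pair; apply: val_inj. Qed.

Lemma measurable_tcons n : measurable_fun setT (@tcons n).
Proof. by apply: measurable_cons. Qed.

Lemma measurable_tuncons n : measurable_fun setT (@tuncons n).
Proof.
apply: measurable_fun_pair; [exact: measurable_tnth | exact: measurable_behead].
Qed.

Section step.
Context n
  (mu : {sigma_finite_measure set (n.-tuple (measurableTypeR R)) -> \bar R}).

Definition lebesgue_step : set (n.+1.-tuple (measurableTypeR R)) -> \bar R :=
  pushforward (@lebesgue_measure R \x mu)%E (@tcons n).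

Let lebesgue_step0 : lebesgue_step set0 = 0%E.
Proof. by rewrite /lebesgue_step /pushforward preimage_set0 measure0. Qed.

Let lebesgue_step_ge0 A : (0 <= lebesgue_step A)%E.
Proof. by rewrite /lebesgue_step /pushforward measure_ge0. Qed.

Let measurable_tcons_preimage A : measurable A -> measurable (@tcons n @^-1` A).
Proof.
by move=> mA; rewrite -[X in measurable X]setTI; exact: measurable_tcons.
Qed.

Let lebesgue_step_sigma_additive : semi_sigma_additive lebesgue_step.
Proof.
move=> F mF tF mUF; rewrite /lebesgue_step /pushforward preimage_bigcup.
apply: measure_semi_sigma_additive.
- by move=> i; exact: measurable_tcons_preimage.
- apply/trivIsetP => /= i j _ _ ij; rewrite -preimage_setI.
  by move/trivIsetP : tF => /(_ _ _ _ _ ij) ->//; rewrite preimage_set0.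
- by rewrite -preimage_bigcup; exact: measurable_tcons_preimage.
Qed.

HB.instance Definition _ := isMeasure.Build _ _ _
  lebesgue_step lebesgue_step0 lebesgue_step_ge0 lebesgue_step_sigma_additive.

Let lebesgue_step_sigma_finite : sigma_finite setT lebesgue_step.
Proof.
have /sigma_finiteP[F [TF ndF Foo]] := sigma_finiteT (@lebesgue_measure R).
have /sigma_finiteP[G [TG ndG Goo]] := sigma_finiteT mu.
exists (fun i => @tuncons n @^-1` (F i `*` G i)).
  rewrite -preimage_bigcup (_ : \bigcup_i _ = setT) ?preimage_setT//.
  rewrite -setXTT TF TG predeqE => -[x y]; split.
    by move=> [i _ [/= Fx Gy]]; split; exists i.
  move=> [/= [i _ Fx] [j _ Gy]]; exists (maxn i j) => //; split => /=.
    by move: x Fx; exact/subsetPset/ndF/leq_maxl.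
  by move: y Gy; exact/subsetPset/ndG/leq_maxr.
move=> i; have [mF Fy] := Foo i; have [mG Gy] := Goo i; split.
  by rewrite -[X in measurable X]setTI; apply: measurable_tuncons => //;
    exact: measurableX.
rewrite /lebesgue_step /pushforward (_ : _ @^-1` _ = F i `*` G i).
  by rewrite product_measure1E// lte_mul_pinfty// ge0_fin_numE.
by apply/funext => p; rewrite -[in RHS](tconsK p).
Qed.

HB.instance Definition _ := Measure_isSigmaFinite.Build _ _ _
  lebesgue_step lebesgue_step_sigma_finite.

End step.

Fixpoint lebesgue_tuple n :
    {sigma_finite_measure set (n.-tuple (measurableTypeR R)) -> \bar R} :=
  match n with
  | 0 => \d_([tuple] : 0.-tuple (measurableTypeR R))
  | n'.+1 => lebesgue_step (lebesgue_tuple n')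
  end.

End lebesgue_tuple.

Section special_functions.
Context (R : realType).

Definition cosh (t : R) : R := (expR t + expR (- t)) / 2.

Definition Gamma (s : R) : R :=
  \int[@lebesgue_measure R]_(t in `]0, +oo[) (t `^ (s - 1) * expR (- t)).

(* Modified Bessel function of the second kind (z > 0), by the integral
   representation K_nu(z) = int_0^oo exp(- z cosh t) cosh(nu t) dt, which
   covers integer and non-integer orders alike. *)
Definition besselK (nu z : R) : R :=
  \int[@lebesgue_measure R]_(t in `[0, +oo[)
    (expR (- (z * cosh t)) * cosh (nu * t)).

(* The formula is singular at r = 0, where K_nu blows up; its limit there is
   sigma2, the variance. *)
Definition matern_kappa (sigma2 nu r : R) : R :=
  if r == 0 then sigma2 else
  let z := Num.sqrt (2 * nu) * r in
  sigma2 * (2 `^ (1 - nu) / Gamma nu) * z `^ nu * besselK nu z.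

End special_functions.

Section complex_integral.
Context (R : realType).

Definition cexpi (t : R) : R[i] := cos t +i* sin t.

Definition cintegral disp (T : measurableType disp)
    (mu : {measure set T -> \bar R}) (f : T -> R[i]) : R[i] :=
  (\int[mu]_x complex.Re (f x)) +i* (\int[mu]_x complex.Im (f x)).

End complex_integral.

Section euclid.
Context (R : realType) (d : nat).
Implicit Types x y : d.-tuple R.

Definition dot x y : R := \sum_(i < d) tnth x i * tnth y i.

(* The library norm on vectors is the sup norm. *)
Definition enorm x : R := Num.sqrt (\sum_(i < d) tnth x i ^+ 2).

Definition intvec (k : d.-tuple int) : d.-tuple R :=
  [tuple (tnth k i)%:~R | i < d].

Definition freq (l : R) (k : d.-tuple int) : d.-tuple R :=
  [tuple (tnth k i)%:~R / (2 * l) | i < d].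

Definition fourier (f : d.-tuple R -> R[i]) (xi : d.-tuple R) : R[i] :=
  cintegral (lebesgue_tuple R d) (fun x => f x * cexpi (- (2 * pi * dot xi x))).

Definition matern (sigma2 lambda nu : R) (x : d.-tuple R) : R :=
  matern_kappa sigma2 nu (enorm x / lambda).

(* Complex-valued; in R[i], 0 < z means that z is real and positive. *)
Definition matern_hat (sigma2 lambda nu : R) : d.-tuple R -> R[i] :=
  fourier (fun x => (matern sigma2 lambda nu x)%:C).

End euclid.

(* The indices are j >= 1: the value k 0 is unconstrained and never used. *)
Definition norm_enumeration (R : realType) d (k : nat -> d.-tuple int) :=
  [/\ set_bij [set j | (1 <= j)%N] setT k,
      k 1 = [tuple 0 | i < d] &
      forall i j, (1 <= i)%N -> (i <= j)%N ->
        enorm (intvec R (k i)) <= enorm (intvec R (k j))].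

(* Main.v *)
Require Import Defs.
From HB Require Import structures.
From mathcomp Require Import all_boot all_order all_algebra complex.
From mathcomp Require Import all_classical all_reals all_analysis.
From mathcomp Require Import measurable_realfun lebesgue_integral_under.
From mathcomp Require Import zify ring lra.

Set Implicit Arguments.
Unset Strict Implicit.
Unset Printing Implicit Defensive.

Import Order.TTheory GRing.Theory Num.Theory.
Import numFieldNormedType.Exports.

Local Open Scope classical_set_scope.
Local Open Scope ring_scope.
Local Open Scope complex_scope.

(** The Matern kernel is a gamma mixture of Gaussians, and that is what makes
its Fourier transform computable. The substitution u = (z / 2) e^t in the
integral defining K_nu(z) gives, with A = nu / (2 lambda^2),

  rho(x) = sigma^2 / Gamma(nu) *
           int_R exp(nu s - e^s) exp(- A |x|^2 e^{- s}) ds,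

where s = ln u; the formula is also right at x = 0, where it reads
Gamma(nu) / Gamma(nu). Keeping s, rather than u, as the variable makes every
integrand smooth on the whole line ([besselE], [matern_kappaE]). The transform
of each Gaussian is again a Gaussian ([gauss_fourier], [gauss_fourier_tuple]),
Tonelli's theorem exchanges the x and s integrals, and the s integral that
remains is a rescaled Gamma(nu + d / 2). This is the closed form [matern_hatE];
its positivity is visible.

For the upper bound put p = nu + d / 2, r = |k(j)| and
B = pi^2 lambda^2 r^2 / (2 nu l^2). The closed form is a constant multiple of

  Gamma(p) / Gamma(nu) * (lambda^2 / nu)^{d / 2} * (1 + B)^{- p},

and Gamma(p) <= G nu^{d / 2} Gamma(nu) with G depending on d only
([Gamma_ratio_le]), so lambda^d (1 + B)^{- p} has to be bounded. As
lambda^d = lambda^{- 2 nu} (lambda^2)^p and 1 + 2 nu / d = (2 / d) p, the claim is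
that the p-th power of

  lambda^2 j^{2 / d} / (nu l^2 + pi^2 lambda^2 r^2 / 2)

is bounded uniformly in all parameters, including nu. Since p is unbounded, a
bound on the quotient itself is not enough: it must be at most 1 once nu is
large. The points k(1), ..., k(j) lie in a cube of side 2 r, whence
j^{2 / d} <= (2 r + 1)^2 ([enumeration_count]). Now 4 < pi^2 / 2, so
(2 r + 1)^2 <= N + pi^2 r^2 / 2 for some constant N ([count_quadratic]); with
lambda <= 1 <= l the quotient is at most 1 if nu > N, and at most 2 N if
1 / 2 <= nu <= N, in which case p <= N + d / 2 ([decay_bound]). *)

(** * Changes of variables on the real line *)

Section line.
Context {R : realType}.
Notation mu := (@lebesgue_measure R).
Implicit Types (f : R -> R) (a b c : R).

Lemma ge0_integral_shift f c : continuous f -> (forall x, 0 <= f x) ->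
  (\int[mu]_x (f (x + c))%:E = \int[mu]_x (f x)%:E)%E.
Proof.
move=> cf f0.
have D1 : derive1 (fun x : R => x + c) = cst 1.
  by apply/funext => x; rewrite derive1E deriveD// derive_id derive_cst addr0.
rewrite [RHS](@increasing_ge0_integration_by_substitutionT R (fun x => x + c)) //.
- by rewrite D1; apply: eq_integral => x _ /=; rewrite mulr1.
- by move=> x y; rewrite ltrD2r.
- by rewrite D1; exact: cst_continuous.
- by rewrite D1; exact: is_cvg_cst.
- by rewrite D1; exact: is_cvg_cst.
- exact: cvg_addrr_Ny.
- exact: cvg_addrr.
Qed.

Lemma ge0_integral_scale f c : 0 < c -> continuous f -> (forall x, 0 <= f x) ->
  (\int[mu]_x (f (c * x))%:E = (c^-1)%:E * \int[mu]_x (f x)%:E)%E.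
Proof.
move=> c0 cf f0.
have D1 : derive1 (fun x : R => c * x) = cst c.
  apply/funext => x; rewrite derive1E deriveM// derive_id derive_cst.
  by rewrite scaler0 addr0 /GRing.scale/= mulr1.
rewrite [in RHS](@increasing_ge0_integration_by_substitutionT R (fun x => c * x)) //.
- transitivity ((c^-1)%:E * (c%:E * \int[mu]_x (f (c * x))%:E))%E.
    by rewrite muleA -EFinM mulVf ?gt_eqF// mul1e.
  congr (_ * _)%E; rewrite -ge0_integralZl//.
  + by rewrite D1; apply: eq_integral => x _; rewrite /= -EFinM mulrC.
  + apply/measurable_EFinP; apply: (measurableT_comp (f := f)).
      exact: continuous_measurable_fun.
    exact: measurable_funM.
  + by move=> x _; rewrite lee_fin.
  + by rewrite lee_fin ltW.
- by move=> x y; rewrite ltr_pM2l.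
- by rewrite D1; exact: cst_continuous.
- by rewrite D1; exact: is_cvg_cst.
- by rewrite D1; exact: is_cvg_cst.
- by apply: gt0_cvgMrNy; [|exact: cvg_id].
- by apply: gt0_cvgMry; [|exact: cvg_id].
Qed.

Lemma ge0_integral_fold f : continuous f -> (forall x, 0 <= f x) ->
  (\int[mu]_x (f x)%:E = \int[mu]_(x in `[0%R, +oo[) (f x + f (- x))%:E)%E.
Proof.
move=> cf f0.
have mf : measurable_fun [set: R] f by exact: continuous_measurable_fun.
have mfN : measurable_fun [set: R] (f \o -%R) by exact: measurableT_comp.
under [RHS]eq_integral do rewrite EFinD.
rewrite ge0_integralD//=; last 4 first.
- by move=> x _; rewrite lee_fin.
- exact/measurable_EFinP/measurable_funTS.
- by move=> x _; rewrite lee_fin.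
- exact/measurable_EFinP/measurable_funTS.
have -> : (\int[mu]_(x in `[0%R, +oo[) (f (- x))%:E =
           \int[mu]_(x in `]-oo, 0%R[) (f x)%:E)%E.
  rewrite integral_itv_bndo_bndc; last exact/measurable_EFinP/measurable_funTS.
  rewrite -{2}oppr0 (ge0_integration_by_substitutionNy (a := 0))//.
  exact: continuous_subspaceT.
have m1 : measurable (`[0%R, +oo[ : set R) by [].
rewrite -(setUv `[(0 : R)%R, +oo[) ge0_integral_setU//=.
- by rewrite setCitvr.
- exact: measurableC.
- by rewrite setUv; exact/measurable_EFinP.
- by move=> x _; rewrite lee_fin.
- exact/disj_setPCl.
Qed.

Lemma integrable_gauss a : 0 < a ->
  mu.-integrable setT (fun x => (expR (- (a * x ^+ 2)))%:E) /\
  (\int[mu]_x (expR (- (a * x ^+ 2)))%:E = (Num.sqrt (pi / a))%:E)%E.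
Proof.
move=> a0.
have E : (\int[mu]_x (expR (- (a * x ^+ 2)))%:E = (Num.sqrt (pi / a))%:E)%E.
  transitivity (\int[mu]_x (gauss_fun (Num.sqrt a * x))%:E)%E.
    by apply: eq_integral => x _; rewrite /gauss_fun exprMn sqr_sqrtr// ltW.
  rewrite ge0_integral_scale ?sqrtr_gt0//; last exact: gauss_fun_ge0.
    rewrite integralT_gauss -EFinM sqrtrM ?pi_ge0// sqrtrV; last exact: ltW.
    by rewrite mulrC.
  exact: continuous_gauss_fun.
split=> //; apply/integrableP; split.
  by apply/measurable_EFinP; apply: measurableT_comp => //;
    apply: measurableT_comp => //; apply: measurable_funM => //.
under eq_integral do rewrite gee0_abs ?lee_fin ?expR_ge0//.
by rewrite E ltry.
Qed.

End line.

(** * The Fourier transform of a Gaussian on the line *)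

Section gauss_phase.
Context {R : realType}.
Notation mu := (@lebesgue_measure R).
Implicit Types (f : R -> R) (a b c : R).

Lemma le_gauss_integrable f a (K : R) : 0 < a -> measurable_fun setT f ->
  (forall x, `|f x| <= K * expR (- (a * x ^+ 2))) ->
  mu.-integrable setT (EFin \o f).
Proof.
move=> a0 mf fK.
apply: (@le_integrable _ _ _ mu setT _ _
  (fun x => K%:E * (expR (- (a * x ^+ 2)))%:E)%E) => //.
- exact/measurable_EFinP.
- move=> x _ /=; rewrite lee_fin (le_trans (fK x))// ler_norm//.
- apply: integrableZl => //.
  exact: (integrable_gauss a0).1.
Qed.

(** Integration by parts without boundary terms: the integral of f (x + c) does
not depend on c, and differentiating it in c at 0 under the integral sign gives
the integral of f'. The translation invariance is that of [ge0_integral_shift],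
hence the hypothesis f >= 0. *)
Lemma Rintegral_derive_shift f (f' G : R -> R) :
  (forall x, 0 <= f x) -> (forall x : R, is_derive x (1 : R) f (f' x)) ->
  mu.-integrable setT (EFin \o f) -> mu.-integrable setT (EFin \o G) ->
  (forall x, 0 <= G x) ->
  (forall c x, -1 < c < 1 -> `|f' (x + c)| <= G x) ->
  \int[mu]_x f' x = 0.
Proof.
move=> f0 df intf intG G0 f'G.
have cf : continuous f.
  by move=> x; apply: differentiable_continuous; apply/derivable1_diffP; have [] := df x.
pose F c x := f (x + c).
have dF (c x : R) : is_derive c (1 : R) (F ^~ x) (f' (x + c)).
  have := @is_derive1_comp R f (fun c => x + c) c _ _ (df (x + c)) _.
  move=> /(_ 1); rewrite mulr1; apply.
  rewrite -[X in is_derive _ _ _ X]add0r; apply: is_deriveD.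
have E c x : partial1of2 F c x = f' (x + c).
  by rewrite /partial1of2 derive1E; have [_] := dF c x.
have intF c : mu.-integrable setT (EFin \o F c).
  have cFc : continuous (F c).
    move=> x; apply: continuous_comp; last exact: cf.
    by apply: cvgD; [exact: cvg_id|exact: cvg_cst].
  apply/integrableP; split.
    by apply/measurable_EFinP; exact: continuous_measurable_fun.
  under eq_integral do rewrite /= ger0_norm ?f0//.
  rewrite ge0_integral_shift//.
  move/integrableP : intf => [_]; under eq_integral do rewrite /= ger0_norm ?f0//.
  by [].
have := @differentiation_under_integral R _ _ mu F setT measurableT 0 (-1) 1 _ _ _ G G0 intG _.
rewrite /= (_ : derive1 _ = cst 0); last first.
  apply/funext => c; rewrite (_ : (fun x' => _) = cst (\int[mu]_x f x)) ?derive1_cst//.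
  apply/funext => d; rewrite /Rintegral/= /F; congr fine.
  exact: ge0_integral_shift.
move=> H; rewrite [RHS]H//.
- by apply: eq_Rintegral => x _; rewrite E addr0.
- by rewrite in_itv/=; lra.
- by move=> c y; rewrite in_itv/= => hc _; rewrite E f'G.
Qed.

(** Half of the Gaussian absorbs the polynomial factor, because
exp(a x^2 / 2) >= 1 + a x^2 / 2. This and the next lemma provide the integrable
majorants for differentiating under the integral sign. *)
Lemma le_norm_gauss a x : 0 < a ->
  `|x| * expR (- (a * x ^+ 2)) <= (1 + 2 / a) * expR (- (a / 2 * x ^+ 2)).
Proof.
move=> a0.
have -> : expR (- (a * x ^+ 2)) = expR (- (a / 2 * x ^+ 2)) * expR (- (a / 2 * x ^+ 2)).
  by rewrite -expRD; congr expR; field.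
rewrite mulrA ler_wpM2r ?expR_ge0// expRN ler_pdivrMr ?expR_gt0//.
have h : 1 + a / 2 * x ^+ 2 <= expR (a / 2 * x ^+ 2) by rewrite expR_ge1Dx.
apply: (@le_trans _ _ ((1 + 2 / a) * (1 + a / 2 * x ^+ 2))); last first.
  by rewrite ler_wpM2l// addr_ge0// divr_ge0// ltW.
have -> : (1 + 2 / a) * (1 + a / 2 * x ^+ 2) = 1 + `|x| ^+ 2 + 2 / a + a / 2 * x ^+ 2.
  rewrite real_normK ?num_real//; field; lra.
have h1 : 0 <= a / 2 * x ^+ 2 by rewrite mulr_ge0 ?sqr_ge0//; lra.
have h2 : 0 <= 2 / a by rewrite divr_ge0// ltW.
have := sqr_ge0 (`|x| - 1); nra.
Qed.

Lemma le_gauss_shift a c x : 0 < a -> -1 < c < 1 ->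
  expR (- (a * (x + c) ^+ 2)) <= expR a * expR (- (a / 2 * x ^+ 2)).
Proof.
move=> a0 hc; rewrite -expRD ler_expR.
have -> : a - a / 2 * x ^+ 2 = - (a * (x + c) ^+ 2) +
   a * (2^-1 * (x + 2 * c) ^+ 2 + (1 - c ^+ 2)) by field.
rewrite lerDl mulr_ge0 ?(ltW a0)// addr_ge0//; last by nra.
by rewrite mulr_ge0// sqr_ge0.
Qed.

Lemma is_derive_gauss a (x : R) :
  is_derive x (1 : R) (fun y => expR (- (a * y ^+ 2)))
    (- (2 * a * x) * expR (- (a * x ^+ 2))).
Proof.
have h : is_derive x (1 : R) (- (a \*: (@GRing.exp R ^~ 2))) (- (2 * a * x)).
  apply: is_derive_eq; rewrite /GRing.scale /=; ring.
have := is_derive1_comp (is_derive_expR _) h.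
by rewrite [X in is_derive _ _ _ X]mulrC.
Qed.

Lemma is_derive_affine b c (x : R) : is_derive x (1 : R) (fun y => b * y + c) b.
Proof.
have : is_derive x (1 : R) ((b \*: id) + cst c) (b *: 1 + 0) by apply: is_deriveD.
by rewrite addr0 /GRing.scale/= mulr1.
Qed.

Lemma is_derive_sin_affine b c (x : R) :
  is_derive x (1 : R) (fun y => sin (b * y + c)) (b * cos (b * x + c)).
Proof.
have := is_derive1_comp (is_derive_sin _) (is_derive_affine b c x).
by rewrite [X in is_derive _ _ _ X]mulrC.
Qed.

Lemma is_derive_cos_affine b c (x : R) :
  is_derive x (1 : R) (fun y => cos (b * y + c)) (- (b * sin (b * x + c))).
Proof.
have := is_derive1_comp (is_derive_cos _) (is_derive_affine b c x).
by rewrite [X in is_derive _ _ _ X]mulrC mulrN.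
Qed.

Definition gauss_wave a c b x : R := expR (- (a * x ^+ 2)) * cos (b * x + c).

Lemma continuous_sin_affine b c : continuous (fun x : R => sin (b * x + c)).
Proof.
move=> x; apply: differentiable_continuous; apply/derivable1_diffP.
by have [] := is_derive_sin_affine b c x.
Qed.

Lemma continuous_gauss a : continuous (fun x : R => expR (- (a * x ^+ 2))).
Proof.
move=> x; apply: differentiable_continuous; apply/derivable1_diffP.
by have [] := is_derive_gauss a x.
Qed.

Lemma measurable_gauss_sin a b c :
  measurable_fun setT (fun x : R => x * expR (- (a * x ^+ 2)) * sin (b * x + c)).
Proof.
apply: measurable_funM; last (apply: continuous_measurable_fun; exact: continuous_sin_affine).
by apply: measurable_funM => //; (apply: continuous_measurable_fun; exact: continuous_gauss).
Qed.

Lemma measurable_gauss_wave a b c : measurable_fun setT (gauss_wave a c b).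
Proof.
apply: measurable_funM; first (apply: continuous_measurable_fun; exact: continuous_gauss).
have -> : (fun x => cos (b * x + c)) = (fun x => sin (b * x + (c + pi / 2))).
  by apply/funext => x; rewrite addrA sinDpihalf.
(apply: continuous_measurable_fun; exact: continuous_sin_affine).
Qed.

Lemma integrable_gauss_wave a b c : 0 < a -> mu.-integrable setT (EFin \o gauss_wave a c b).
Proof.
move=> a0; apply: (le_gauss_integrable (K := 1) a0); first exact: measurable_gauss_wave.
move=> x; rewrite /gauss_wave normrM ger0_norm ?expR_ge0// mulrC ler_wpM2r ?expR_ge0//.
by rewrite ler_norml cos_geN1 cos_le1.
Qed.

Lemma integrable_gauss_sin a b c : 0 < a -> mu.-integrable setT
  (fun x => (x * expR (- (a * x ^+ 2)) * sin (b * x + c))%:E).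
Proof.
move=> a0.
apply: (le_gauss_integrable (K := 1 + 2 / a) (a := a / 2)).
- by rewrite divr_gt0.
- exact: measurable_gauss_sin.
- move=> x; apply: le_trans (le_norm_gauss x a0).
  rewrite !normrM (ger0_norm (expR_ge0 _)) ler_piMr ?mulr_ge0 ?expR_ge0//.
  by rewrite ler_norml sin_geN1 sin_le1.
Qed.

(** The vanishing of the integral of d/dx (exp(- a x^2) (sin (b x + c) + 1)). The
summand 1 makes the differentiated function nonnegative; the odd term
- 2 a x exp(- a x^2) that it adds is removed afterwards by the instance in which
the sine vanishes identically. *)
Lemma gauss_by_parts a b c : 0 < a ->
  \int[mu]_x (b * gauss_wave a c b x -
     2 * a * (x * expR (- (a * x ^+ 2)) * sin (b * x + c))) = 0.
Proof.
move=> a0.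
pose f' b c (x : R) := expR (- (a * x ^+ 2)) * (b * cos (b * x + c)) +
  - (2 * a * x) * expR (- (a * x ^+ 2)) * (sin (b * x + c) + 1).
have key b' c' : \int[mu]_x f' b' c' x = 0.
  pose M := (`|b'| + 4 * a * (1 + 2 / a)).
  have M0 : 0 <= M by rewrite addr_ge0// mulr_ge0 ?addr_ge0 ?divr_ge0//; lra.
  pose f (x : R) := expR (- (a * x ^+ 2)) * (sin (b' * x + c') + 1).
  apply: (@Rintegral_derive_shift f (f' b' c')
     (fun x => M * expR (a / 2) * expR (- (a / 4 * x ^+ 2)))).
  - by move=> x; rewrite mulr_ge0 ?expR_ge0//; have := sin_geN1 (b' * x + c'); lra.
  - move=> x; have h := is_derive_gauss a x.
    have h2 : is_derive x (1 : R) ((fun y => sin (b' * y + c')) + cst 1)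
                (b' * cos (b' * x + c') + 0).
      by apply: is_deriveD; exact: is_derive_sin_affine.
    rewrite addr0 in h2.
    apply: is_derive_eq (is_deriveM h h2) _.
    by rewrite /f' /GRing.scale/= [X in _ + X = _]mulrC.
  - apply: (le_gauss_integrable (K := 2) a0).
      apply: measurable_funM; first (apply: continuous_measurable_fun; exact: continuous_gauss).
      apply: measurable_funD => //.
      (apply: continuous_measurable_fun; exact: continuous_sin_affine).
    move=> x; rewrite /f normrM ger0_norm ?expR_ge0// mulrC ler_wpM2r ?expR_ge0//.
    by have := sin_geN1 (b' * x + c'); have := sin_le1 (b' * x + c');
       rewrite ler_norml; lra.
  - apply: (le_gauss_integrable (a := a / 4) (K := M * expR (a / 2))).
    + by rewrite divr_gt0.
    + apply: measurable_funM => //.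
      (apply: continuous_measurable_fun; exact: continuous_gauss).
    + by move=> x; rewrite ger0_norm// !mulr_ge0 ?expR_ge0.
  - by move=> x; rewrite !mulr_ge0 ?expR_ge0.
  - move=> d x hd.
    have a20 : 0 < a / 2 by rewrite divr_gt0.
    have := le_gauss_shift x a20 hd.
    rewrite (_ : a / 2 / 2 = a / 4); last by field.
    move=> h; rewrite -mulrA.
    apply: (@le_trans _ _ (M * expR (- (a / 2 * (x + d) ^+ 2)))); last by rewrite ler_wpM2l.
    move: (x + d) => y.
    have h1 := le_norm_gauss y a0.
    have h2 : expR (- (a * y ^+ 2)) <= expR (- (a / 2 * y ^+ 2)).
      rewrite ler_expR lerN2; have := sqr_ge0 y; nra.
    have e0 := expR_ge0 (- (a * y ^+ 2)).
    have hs : `|sin (b' * y + c') + 1| <= 2.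
      by have := sin_geN1 (b' * y + c'); have := sin_le1 (b' * y + c');
       rewrite ler_norml; lra.
    have hc : `|cos (b' * y + c')| <= 1 by rewrite ler_norml cos_geN1 cos_le1.
    rewrite /f' (le_trans (ler_normD _ _))// !normrM !normrN !normrM.
    rewrite (ger0_norm e0) (ger0_norm (ltW a0)) (ger0_norm (ler0n _ _)).
    rewrite /M [X in _ <= X]mulrDl; apply: lerD.
      rewrite mulrCA ler_wpM2l//.
      by apply: le_trans h2; rewrite ler_piMr.
    apply: (@le_trans _ _ (4 * a * (`|y| * expR (- (a * y ^+ 2))))); last first.
      by rewrite -[X in _ <= X]mulrA ler_wpM2l// mulr_ge0// ltW.
    rewrite (_ : 4 * a * _ = 2 * a * `|y| * expR (- (a * y ^+ 2)) * 2); last by ring.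
    by rewrite ler_wpM2l// !mulr_ge0// ltW.
(* k is x exp(- a x^2), written so that the integrability lemma above applies. *)
pose k (x : R) := x * expR (- (a * x ^+ 2)) * sin (0 * x + pi / 2).
have ik : mu.-integrable setT (EFin \o k) by exact: integrable_gauss_sin.
have k0 : \int[mu]_x k x = 0.
  have := key 0 0.
  rewrite (_ : f' 0 0 = (fun x => - (2 * a) * k x)); last first.
    by apply/funext => x; rewrite /f' /k !mul0r !add0r sin_pihalf sin0; ring.
  rewrite RintegralZl//; move=> /eqP; rewrite mulf_eq0 => /orP[|/eqP//].
  by rewrite oppr_eq0 mulf_eq0 (gt_eqF a0) pnatr_eq0.
have := key b c.
rewrite (_ : f' b c = (fun x => (b * gauss_wave a c b x -
     2 * a * (x * expR (- (a * x ^+ 2)) * sin (b * x + c))) - 2 * a * k x)); last first.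
  by apply/funext => x; rewrite /f' /gauss_wave /k mul0r add0r sin_pihalf; ring.
rewrite RintegralB//; first by rewrite RintegralZl// k0 mulr0 subr0.
- under [X in _.-integrable _ X]eq_fun do rewrite EFinB !EFinM.
  apply: integrableB => //; apply: integrableZl => //; first exact: integrable_gauss_wave.
  exact: integrable_gauss_sin.
- by under [X in _.-integrable _ X]eq_fun do rewrite EFinM; apply: integrableZl.
Qed.

(** Differentiating under the integral sign turns the cosine into - x sin, which
[gauss_by_parts] turns back: the transform T satisfies T' = - (b / 2 a) T. *)
Lemma is_derive_gauss_fourier a c b : 0 < a ->
  is_derive b (1 : R) (fun b => \int[mu]_x gauss_wave a c b x)
    (- (b / (2 * a)) * \int[mu]_x gauss_wave a c b x).
Proof.
move=> a0.
have d1 (d x : R) : is_derive d (1 : R) (fun d => gauss_wave a c d x)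
    (- (x * expR (- (a * x ^+ 2)) * sin (d * x + c))).
  have h : is_derive d (1 : R)
      (expR (- (a * x ^+ 2)) \*: (fun d => cos (x * d + c)))
      (expR (- (a * x ^+ 2)) *: (- (x * sin (x * d + c)))).
    by apply: is_deriveZ; exact: is_derive_cos_affine.
  have -> : (fun d => gauss_wave a c d x) =
      expR (- (a * x ^+ 2)) \*: (fun d => cos (x * d + c)).
    by apply/funext => y; rewrite /gauss_wave mulrC [y * x]mulrC mulrC.
  by apply: is_derive_eq; rewrite /GRing.scale/= [d * x]mulrC; ring.
have E (d x : R) : partial1of2 (gauss_wave a c) d x =
    (- (x * expR (- (a * x ^+ 2)) * sin (d * x + c))).
  by rewrite /partial1of2 derive1E; have [_] := d1 d x.
have iG : mu.-integrable setT (EFin \o (fun x => (1 + 2 / a) * expR (- (a / 2 * x ^+ 2)))).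
  apply: (le_gauss_integrable (a := a / 2) (K := (1 + 2 / a))).
  - by rewrite divr_gt0.
  - apply: measurable_funM => //; (apply: continuous_measurable_fun; exact: continuous_gauss).
  - by move=> x; rewrite ger0_norm// mulr_ge0 ?expR_ge0// addr_ge0// divr_ge0// ltW.
have G0 (x : R) : 0 <= (1 + 2 / a) * expR (- (a / 2 * x ^+ 2)).
  by rewrite mulr_ge0 ?expR_ge0// addr_ge0// divr_ge0// ltW.
have Ib : `]b - 1, b + 1[%classic b by rewrite /= in_itv/=; lra.
have ig (x : R) : `]b - 1, b + 1[%classic x -> mu.-integrable setT (EFin \o gauss_wave a c x).
  by move=> _; exact: integrable_gauss_wave.
have dg (x y : R) : `]b - 1, b + 1[%classic x -> [set: R] y ->
    derivable ((gauss_wave a c) ^~ y) x 1.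
  by move=> _ _; have [] := d1 x y.
have ub (x y : R) : `]b - 1, b + 1[%classic x -> [set: R] y ->
    `|partial1of2 (gauss_wave a c) x y| <= (1 + 2 / a) * expR (- (a / 2 * y ^+ 2)).
  move=> _ _; rewrite E normrN; apply: le_trans (le_norm_gauss y a0).
  rewrite !normrM (ger0_norm (expR_ge0 _)) ler_piMr ?mulr_ge0 ?expR_ge0//.
  by rewrite ler_norml sin_geN1 sin_le1.
have D := @derivable_under_integral R _ _ mu _ setT measurableT b _ _ Ib ig dg _ G0 iG ub.
have V := @differentiation_under_integral R _ _ mu _ setT measurableT b _ _ Ib ig dg _ G0 iG ub.
apply: DeriveDef; first exact: D.
rewrite -derive1E V.
under eq_Rintegral do rewrite E -mulN1r.
rewrite RintegralZl//; last exact: integrable_gauss_sin.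
have := gauss_by_parts b c a0.
rewrite RintegralB//; last 2 first.
- under [X in _.-integrable _ X]eq_fun do rewrite EFinM.
  by apply: integrableZl => //; exact: integrable_gauss_wave.
- under [X in _.-integrable _ X]eq_fun do rewrite EFinM.
  by apply: integrableZl => //; exact: integrable_gauss_sin.
rewrite !RintegralZl//; last 2 first.
- exact: integrable_gauss_sin.
- exact: integrable_gauss_wave.
move=> /eqP; rewrite subr_eq0 => /eqP h.
rewrite mulN1r mulNr; congr (- _).
by rewrite [RHS]mulrAC h [RHS]mulrC mulKf// mulf_neq0 ?gt_eqF.
Qed.

(** By the differential equation above, T(b) exp(b^2 / 4 a) is constant. The free
phase c yields the cosine and the sine transform at once, and it is what lets the
formula be iterated over coordinates. *)
Lemma gauss_fourier a b c : 0 < a ->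
  \int[mu]_x (expR (- (a * x ^+ 2)) * cos (b * x + c)) =
  Num.sqrt (pi / a) * expR (- (b ^+ 2 / (4 * a))) * cos c.
Proof.
move=> a0; rewrite -[LHS]/(\int[mu]_x gauss_wave a c b x).
pose T b := \int[mu]_x gauss_wave a c b x.
have dT (d : R) : is_derive d (1 : R)
    (fun d => T d * expR (- (- (4 * a)^-1 * d ^+ 2))) 0.
  have := is_deriveM (is_derive_gauss_fourier c d a0) (is_derive_gauss (- (4 * a)^-1) d).
  rewrite /GRing.scale /= -/(T d) => h; apply: is_derive_eq.
  by field; rewrite gt_eqF.
have := is_derive_0_is_cst b 0 dT.
rewrite expr0n /= mulr0 oppr0 expR0 mulr1.
have -> : T 0 = Num.sqrt (pi / a) * cos c.
  rewrite /T /gauss_wave; under eq_Rintegral do rewrite mul0r add0r mulrC.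
  rewrite RintegralZl//; last exact: (integrable_gauss a0).1.
  by rewrite /Rintegral (integrable_gauss a0).2 mulrC.
move=> h; rewrite mulrAC -h -mulrA -expRD.
by rewrite (_ : _ + _ = 0) ?expR0 ?mulr1//; field; rewrite gt_eqF.
Qed.

End gauss_phase.

(** * The gamma function and the modified Bessel function as integrals over the line *)

Section gamma.
Context {R : realType}.
Notation mu := (@lebesgue_measure R).
Implicit Types (a s c z nu : R).

Lemma cvg_lny : @ln R x @[x --> +oo] --> +oo.
Proof.
apply/cvgryPge => A; near=> x.
rewrite -[A]expRK ler_ln ?posrE ?expR_gt0//.
Unshelve. all: end_near. Qed.

Lemma ge0_integral_ln (G : R -> R) a : 0 < a -> continuous G -> (forall x, 0 <= G x) ->
  (\int[mu]_(x in `[ln a, +oo[) (G x)%:E =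
   \int[mu]_(u in `[a, +oo[) (G (ln u) / u)%:E)%E.
Proof.
move=> a0 cG G0.
have dln (x : R) : 0 < x -> derive1 (@ln R) x = x^-1.
  by move=> x0; rewrite derive1E; have [_] := is_derive1_ln x0.
rewrite (increasing_ge0_integration_by_substitutiony (F := @ln R)) //.
- apply: eq_integral => x; rewrite inE /= in_itv/= andbT => ax.
  by rewrite -(dln x (lt_le_trans a0 ax)).
- move=> x y; rewrite !in_itv/= !andbT => ax ay xy.
  by rewrite ltr_ln ?posrE//; [exact: lt_le_trans ax|exact: lt_le_trans ay].
- move=> x; rewrite in_itv/= andbT => ax; have x0 := lt_trans a0 ax.
  have : x^-1 @[x --> x] --> x^-1 by apply: cvgV => //; rewrite gt_eqF.
  rewrite /continuous_at dln//; apply: cvg_trans; apply: near_eq_cvg.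
  near=> y; rewrite dln//; near: y; exact: lt_nbhsr.
- apply/cvg_ex; exists a^-1.
  have : x^-1 @[x --> a^'+] --> a^-1.
    by apply: cvg_at_right_filter; apply: cvgV => //; rewrite gt_eqF.
  apply: cvg_trans; apply: near_eq_cvg.
  by near=> y; rewrite dln// (lt_trans a0).
- apply/cvg_ex; exists 0.
  have : (x : R)^-1 @[x --> +oo] --> 0.
    by apply/gtr0_cvgV0; [near=> x; near: x; apply: nbhs_pinfty_gt; rewrite num_real|exact: cvg_id].
  apply: cvg_trans; apply: near_eq_cvg; near=> y; rewrite dln//.
- split.
    move=> x; rewrite in_itv/= andbT => ax.
    by have [] := is_derive1_ln (lt_trans a0 ax).
  by apply: cvg_at_right_filter; apply: continuous_ln.
- exact: cvg_lny.
- exact: continuous_subspaceT.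
Unshelve. all: end_near. Qed.

(** The substitution u = e^x. It is made through its inverse ln on the half-lines
[e^{- n}, +oo[, where the derivative 1 / u has a limit at +oo (that of e^x has
none), and n tends to infinity by monotone convergence. *)
Lemma ge0_integral_expR (G : R -> R) : continuous G -> (forall x, 0 <= G x) ->
  (\int[mu]_x (G x)%:E = \int[mu]_(u in `]0%R, +oo[) (G (ln u) / u)%:E)%E.
Proof.
move=> cG G0.
pose A n := (`[ - n%:R, +oo[%classic : set (measurableTypeR R)).
pose B n := (`[ expR (- n%:R), +oo[%classic : set (measurableTypeR R)).
have UA : \bigcup_n A n = setT.
  apply/seteqP; split=> // x _; exists (Num.truncn `|x|).+1 => //.
  rewrite /A /= in_itv/= andbT.
  by have := truncnS_gt `|x|; have := ler_norm (- x); rewrite normrN; lra.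
have UB : \bigcup_n B n = `]0%R, +oo[%classic.
  apply/seteqP; split=> x.
    by move=> [n _]; rewrite /B /= !in_itv/= !andbT; apply: lt_le_trans; exact: expR_gt0.
  rewrite /= in_itv/= andbT => x0; exists (Num.truncn `|ln x|).+1 => //.
  rewrite /B /= in_itv/= andbT -[x in _ <= x]lnK ?posrE// ler_expR.
  by have := truncnS_gt `|ln x|; have := ler_norm (- ln x); rewrite normrN; lra.
have mG : measurable_fun setT (fun x => (G x)%:E).
  by apply/measurable_EFinP; exact: continuous_measurable_fun.
have mln : measurable_fun (`]0%R, +oo[ : set R) (fun u => (G (ln u) / u)%:E).
  apply/measurable_EFinP; apply: open_continuous_measurable_fun => //.
  move=> x; rewrite inE/= in_itv/= andbT => x0; apply: cvgM.
    by apply: continuous_comp; [exact: continuous_ln|exact: cG].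
  by apply: cvgV; [rewrite gt_eqF|exact: cvg_id].
have cA : (\int[mu]_(x in A n) (G x)%:E @[n --> \oo] --> \int[mu]_x (G x)%:E)%E.
  rewrite -UA; apply: ge0_nondecreasing_set_cvg_integral.
  - apply/nondecreasing_seqP => n; apply/subsetPset => x; rewrite /A/= !in_itv/= !andbT.
    by apply: le_trans; rewrite lerN2 ler_nat.
  - by move=> n; exact: measurable_itv.
  - by move=> n; exact: measurable_funTS.
  - by move=> n x _; rewrite lee_fin.
have cB : (\int[mu]_(u in B n) (G (ln u) / u)%:E @[n --> \oo] -->
    \int[mu]_(u in `]0%R, +oo[) (G (ln u) / u)%:E)%E.
  rewrite -UB; apply: ge0_nondecreasing_set_cvg_integral.
  - apply/nondecreasing_seqP => n; apply/subsetPset => x; rewrite /B/= !in_itv/= !andbT.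
    by apply: le_trans; rewrite ler_expR lerN2 ler_nat.
  - by move=> n; exact: measurable_itv.
  - move=> n; apply: measurable_funS mln => //; rewrite -UB; exact: bigcup_sup.
  - move=> n x; rewrite /B/= in_itv/= andbT => h; rewrite lee_fin divr_ge0//.
    by apply: le_trans h; exact: expR_ge0.
rewrite -[LHS](cvg_lim _ cA)// -[RHS](cvg_lim _ cB)//.
congr (limn _); apply/funext => n.
by have := ge0_integral_ln (expR_gt0 (- n%:R)) cG G0; rewrite expRK.
Qed.

Lemma GammaE s :
  Gamma s = \int[mu]_x expR (s * x - expR x).
Proof.
rewrite /Gamma /Rintegral ge0_integral_expR.
- congr fine; apply: eq_integral => u; rewrite inE/= in_itv/= andbT => u0.
  rewrite expRD lnK ?posrE// mulrAC; congr (_ * _)%:E.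
  by rewrite /powR gt_eqF// mulrBl mul1r expRD expRN lnK.
- move=> x; apply: continuous_comp; last exact: continuous_expR.
  apply: cvgB; last exact: continuous_expR.
  by apply: cvgM; [exact: cvg_cst|exact: cvg_id].
- by move=> x; exact: expR_ge0.
Qed.

(** In the variable u = e^x, this is the density of the generalised inverse Gaussian
law, u^{s - 1} exp(- c u - d / u) du, up to normalisation. The gamma integral
(d = 0), the Bessel integral (c = d) and the mixture that represents the Matern
kernel (c = 1) are all of this form. *)
Definition gig s c d (x : R) : R := expR (s * x - c * expR x - d * expR (- x)).

Lemma gig_ge0 s c d x : 0 <= gig s c d x.
Proof. exact: expR_ge0. Qed.

Lemma continuous_gig s c d : continuous (gig s c d).
Proof.
move=> x; apply: continuous_comp; last exact: continuous_expR.
apply: cvgB; first apply: cvgB.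
- by apply: cvgM; [exact: cvg_cst|exact: cvg_id].
- by apply: cvgM; [exact: cvg_cst|exact: continuous_expR].
- apply: cvgM; first exact: cvg_cst.
  apply: continuous_comp; last exact: continuous_expR.
  by apply: cvgN; exact: cvg_id.
Qed.

Lemma measurable_gig s c d : measurable_fun setT (gig s c d).
Proof. by apply: continuous_measurable_fun; exact: continuous_gig. Qed.

(** The integrand is O(exp(- s |x|)): at - oo because of s x, at + oo because
e^x >= (x / 2)^2 beats the linear terms. *)
Lemma integral_gig_fin s : 0 < s ->
  (\int[mu]_x (gig s 1 0 x)%:E < +oo)%E.
Proof.
move=> s0; rewrite ge0_integral_fold; last 2 first.
- exact: continuous_gig.
- exact: gig_ge0.
pose K := (expR (4 * s ^+ 2) + 1) / s.
apply: (@le_lt_trans _ _ (K%:E * \int[mu]_x (exponential_pdf s x)%:E)%E); last first.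
  by rewrite integral_exponential_pdf// mule1 ltry.
have K0 : 0 <= K by rewrite divr_ge0 ?addr_ge0 ?expR_ge0 ?(ltW s0).
have p0 x : 0 <= exponential_pdf s x by apply: exponential_pdf_ge0; rewrite ltW.
have mp : measurable_fun setT (fun x => (exponential_pdf s x)%:E).
  by apply/measurable_EFinP; exact: measurable_exponential_pdf.
rewrite -ge0_integralZl//; last by move=> x _; rewrite lee_fin.
apply: (@le_trans _ _ (\int[mu]_(x in `[0%R, +oo[) (K%:E * (exponential_pdf s x)%:E))%E).
  apply: ge0_le_integral => //.
  - by move=> x _; rewrite lee_fin addr_ge0// gig_ge0.
  - apply: measurable_funTS; apply/measurable_EFinP; apply: measurable_funD.
      exact: measurable_gig.
    by apply: measurableT_comp => //; exact: measurable_gig.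
  - by apply: measurable_funTS; apply: emeasurable_funM.
  - move=> x; rewrite /= in_itv/= andbT => x0; rewrite -EFinM lee_fin exponential_pdfE//.
    rewrite /K mulrA mulfVK ?gt_eqF// mulrDl mul1r /gig !mul0r !subr0 !mul1r.
    apply: lerD.
      rewrite -expRD ler_expR.
      have h : (x / 2) ^+ 2 <= expR x.
        rewrite [X in expR X](_ : x = x / 2 * 2%:R); last by rewrite mulfVK.
        rewrite expRM_natr ler_pXn2r ?nnegrE ?expR_ge0 ?divr_ge0//.
        by have := expR_ge1Dx (x / 2); lra.
      have := sqr_ge0 (x / 2 - 2 * s); nra.
    by rewrite ler_expR mulrN mulNr lerBlDr lerDl expR_ge0.
apply: ge0_subset_integral => //.
- by apply: emeasurable_funM.
- by move=> x _; rewrite mule_ge0 ?lee_fin.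
Qed.

Lemma GammaEFin s : 0 < s ->
  (\int[mu]_x (gig s 1 0 x)%:E = (Gamma s)%:E)%E.
Proof.
move=> s0; rewrite GammaE (_ : (fun x => _) = gig s 1 0); last first.
  by apply/funext => x; rewrite /gig mul0r subr0 mul1r.
rewrite /Rintegral fineK// ge0_fin_numE ?integral_gig_fin//.
by apply: integral_ge0 => x _; rewrite lee_fin expR_ge0.
Qed.

Lemma Gamma_gt0 s : 0 < s -> 0 < Gamma s.
Proof.
move=> s0; rewrite -lte_fin -GammaEFin//.
apply: (@lt_le_trans _ _ (\int[mu]_(x in `[0%R, 1%R]) (expR (- expR 1))%:E)%E).
  rewrite integral_cst//= lebesgue_measure_itv/= lte_fin ltr01 oppr0 adde0 mule1.
  by rewrite lte_fin expR_gt0.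
apply: (@le_trans _ _ (\int[mu]_(x in `[0%R, 1%R]) (gig s 1 0 x)%:E)%E).
  apply: ge0_le_integral => //.
  - apply: measurable_funTS; apply/measurable_EFinP; exact: measurable_gig.
  - move=> x; rewrite /= in_itv/= => /andP[x0 x1].
    rewrite lee_fin /gig ler_expR mul0r subr0 mul1r.
    have : 0 <= s * x by rewrite mulr_ge0// ltW.
    have : expR x <= expR 1 by rewrite ler_expR.
    lra.
apply: ge0_subset_integral => //.
- by apply/measurable_EFinP; exact: measurable_gig.
- by move=> x _; rewrite lee_fin gig_ge0.
Qed.

(** The scaling u -> u / c of the gamma integral is a translation by - ln c in the
variable x = ln u. *)
Lemma integral_gig_scale s c : 0 < s -> 0 < c ->
  (\int[mu]_x (gig s c 0 x)%:E = (Gamma s * c `^ (- s))%:E)%E.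
Proof.
move=> s0 c0.
rewrite mulrC EFinM -GammaEFin// -ge0_integralZl//; last 3 first.
- by apply/measurable_EFinP; exact: measurable_gig.
- by move=> x _; rewrite lee_fin gig_ge0.
- by rewrite lee_fin powR_ge0.
rewrite -(ge0_integral_shift (- ln c)); last 2 first.
- exact: continuous_gig.
- exact: gig_ge0.
apply: eq_integral => x _; rewrite -EFinM; congr EFin.
rewrite /powR gt_eqF// /gig -expRD !mul0r !subr0 expRD expRN lnK//; congr expR.
by field; rewrite gt_eqF.
Qed.

(** Folding the line at 0 turns exp(nu t - z cosh t) into
2 exp(- z cosh t) cosh(nu t); translating t by ln (z / 2) makes the coefficient
of e^t equal to 1 and that of e^{- t} equal to z^2 / 4. *)
Lemma besselE nu z : 0 < nu -> 0 < z ->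
  \int[mu]_x gig nu 1 (z ^+ 2 / 4) x = 2 `^ (1 - nu) * z `^ nu * besselK nu z.
Proof.
move=> nu0 z0.
have z20 : 0 < z / 2 by rewrite divr_gt0.
pose I := (\int[mu]_x (gig nu 1 (z ^+ 2 / 4) x)%:E)%E.
pose B := (\int[mu]_(t in `[0%R, +oo[) (expR (- (z * cosh t)) * cosh (nu * t))%:E)%E.
have m1 : measurable_fun setT (fun x => (gig nu 1 (z ^+ 2 / 4) x)%:E).
  by apply/measurable_EFinP; exact: measurable_gig.
have Ifin : I \is a fin_num.
  rewrite ge0_fin_numE; last by apply: integral_ge0 => x _; rewrite lee_fin gig_ge0.
  apply: le_lt_trans (integral_gig_fin nu0); apply: ge0_le_integral => //.
  - by move=> x _; rewrite lee_fin gig_ge0.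
  - by apply/measurable_EFinP; exact: measurable_gig.
  - move=> x _; rewrite lee_fin ler_expR mul0r subr0 lerBlDr lerDl.
    by rewrite mulr_ge0 ?expR_ge0// divr_ge0// sqr_ge0.
have h1 : (\int[mu]_x (gig nu (z / 2) (z / 2) x)%:E = ((z / 2) `^ (- nu))%:E * I)%E.
  rewrite -(ge0_integral_shift (- ln (z / 2))); last 2 first.
  - exact: continuous_gig.
  - exact: gig_ge0.
  rewrite /I -ge0_integralZl//; last 2 first.
  - by move=> x _; rewrite lee_fin gig_ge0.
  - by rewrite lee_fin powR_ge0.
  apply: eq_integral => x _; rewrite -EFinM; congr EFin.
  have e1 : expR (x - ln (z / 2)) = expR x / (z / 2) by rewrite expRD expRN lnK.
  have e2 : expR (- (x - ln (z / 2))) = expR (- x) * (z / 2).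
    by rewrite opprD opprK expRD lnK.
  rewrite /powR gt_eqF// /gig -expRD e1 e2; congr expR.
  by field; rewrite gt_eqF.
have h2 : (\int[mu]_x (gig nu (z / 2) (z / 2) x)%:E = 2%:E * B)%E.
  rewrite ge0_integral_fold; last 2 first.
  - exact: continuous_gig.
  - exact: gig_ge0.
  have E x : gig nu (z / 2) (z / 2) x + gig nu (z / 2) (z / 2) (- x) =
      2 * (expR (- (z * cosh x)) * cosh (nu * x)).
    rewrite /cosh [2 * _](_ : _ = expR (- (z * ((expR x + expR (- x)) / 2))) * expR (nu * x) +
      expR (- (z * ((expR x + expR (- x)) / 2))) * expR (- (nu * x))); last by field.
    by rewrite /gig -!expRD opprK; congr (expR _ + expR _); field.
  have E2 x : expR (- (z * cosh x)) * cosh (nu * x) = 2^-1 *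
      (gig nu (z / 2) (z / 2) x + gig nu (z / 2) (z / 2) (- x)).
    by rewrite E mulKf.
  rewrite /B -ge0_integralZl//.
  - by apply: eq_integral => x _; rewrite E EFinM.
  - apply: measurable_funTS; apply/measurable_EFinP.
    under eq_fun do rewrite E2.
    apply: measurable_funM => //; apply: measurable_funD; first exact: measurable_gig.
    by apply: measurableT_comp => //; exact: measurable_gig.
  - by move=> x _; rewrite lee_fin E2 mulr_ge0// addr_ge0// gig_ge0.
have hB : B = (((z / 2) `^ (- nu) / 2)%:E * I)%E.
  rewrite mulrC EFinM -muleA -h1 h2 muleA -EFinM mulVf// mul1e.
  by [].
rewrite /besselK /Rintegral -/B -/I hB fineM//= -/I.
rewrite /powR !gt_eqF// lnM ?posrE// lnV ?posrE//.
rewrite mulrA mulrA -!expRD.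
rewrite [X in expR X](_ : _ = ln 2); last by ring.
by rewrite lnK ?posrE// mulfV// mul1r.
Qed.

Lemma matern_kappaE sigma2 nu r : 0 < nu -> 0 <= r ->
  matern_kappa sigma2 nu r =
  sigma2 / Gamma nu * \int[mu]_x gig nu 1 (nu / 2 * r ^+ 2) x.
Proof.
move=> nu0 r0; rewrite /matern_kappa; case: eqP => [->|/eqP rn0].
  rewrite expr0n/= mulr0 /Rintegral GammaEFin//= mulfVK// gt_eqF//.
  exact: Gamma_gt0.
have {r0 rn0} r0 : 0 < r by rewrite lt_def rn0.
have z0 : 0 < Num.sqrt (2 * nu) * r by rewrite mulr_gt0// sqrtr_gt0 mulr_gt0.
have := besselE nu0 z0.
rewrite exprMn sqr_sqrtr ?mulr_ge0 ?(ltW nu0)// => h.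
rewrite [nu / 2 * _](_ : _ = 2 * nu * r ^+ 2 / 4); last by field.
by rewrite h; ring.
Qed.

End gamma.

(** * Gaussians on n-tuples *)

Section tuple_integral.
Context {R : realType}.
Notation mu := (@lebesgue_measure R).
Implicit Types (a b c : R).

Definition sqnorm n (x : n.-tuple R) : R := \sum_(i < n) tnth x i ^+ 2.

Lemma ge0_integral_tcons n (f : n.+1.-tuple (measurableTypeR R) -> \bar R) :
  measurable_fun setT f -> (forall x, (0 <= f x)%E) ->
  (\int[lebesgue_tuple R n.+1]_x f x =
   \int[mu]_x \int[lebesgue_tuple R n]_t f (tcons (x, t)))%E.
Proof.
move=> mf f0.
pose g : {mfun _ >-> _} := mfun_Sub (mem_set (@measurable_tcons R n)).
transitivity (\int[pushforward (mu \x lebesgue_tuple R n)%E g]_x f x)%E.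
  by apply: eq_measure_integral.
rewrite ge0_integral_pushforward// preimage_setT fubini_tonelli1//; last by move=> x; exact: f0.
by apply: measurableT_comp => //; exact: measurable_tcons.
Qed.

Lemma measurable_sqnorm n :
  measurable_fun setT (fun x : n.-tuple (measurableTypeR R) => sqnorm x).
Proof.
apply: measurable_sum => i; apply: measurable_funX; exact: measurable_tnth.
Qed.

Lemma measurable_dot n (b : n.-tuple R) :
  measurable_fun setT (fun x : n.-tuple (measurableTypeR R) => dot b x).
Proof.
by apply: measurable_sum => i; apply: measurable_funM => //; exact: measurable_tnth.
Qed.

Lemma sqnorm_tcons n (x : R) (t : n.-tuple R) :
  sqnorm (tcons (x, t)) = x ^+ 2 + sqnorm t.
Proof.
rewrite /sqnorm big_ord_recl tnth0; congr (_ + _).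
by apply: eq_bigr => i _; rewrite tnthS.
Qed.

Lemma dot_tcons n (b : n.+1.-tuple R) (x : R) (t : n.-tuple R) :
  dot b (tcons (x, t)) = thead b * x + dot [tuple of behead b] t.
Proof.
rewrite /dot big_ord_recl tnth0; congr (_ + _).
apply: eq_bigr => i _; rewrite tnthS; congr (_ * _).
by rewrite {1}(tuple_eta b) tnthS.
Qed.

Lemma measurable_cos : measurable_fun setT (@cos R).
Proof. by apply: continuous_measurable_fun; exact: continuous_cos. Qed.

Lemma measurable_gauss_tuple n a (b : n.-tuple R) c : measurable_fun setT
  (fun x : n.-tuple (measurableTypeR R) =>
    expR (- (a * sqnorm x)) * (1 + cos (dot b x + c))).
Proof.
apply: measurable_funM.
  apply: measurableT_comp => //; apply: measurableT_comp => //.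
  apply: measurable_funM => //; exact: measurable_sqnorm.
apply: measurable_funD => //; apply: (measurableT_comp measurable_cos).
by apply: measurable_funD => //; exact: measurable_dot.
Qed.

(** The form in which the one-dimensional transform enters the induction on the
dimension: A is the contribution of the constant 1 and B cos that of the
cosine of the remaining coordinates. *)
Lemma gauss_fourier_affine a b c (A B : R) : 0 < a ->
  (\int[mu]_x (expR (- (a * x ^+ 2)) * (A + B * cos (b * x + c)))%:E =
  (Num.sqrt (pi / a) * (A + B * (expR (- (b ^+ 2 / (4 * a))) * cos c)))%:E)%E.
Proof.
move=> a0; have [ig Eg] := integrable_gauss a0.
have i1 : mu.-integrable setT (fun x => (A * expR (- (a * x ^+ 2)))%:E).
  by under eq_fun do rewrite EFinM; exact: integrableZl.
have ic := integrable_gauss_wave b c a0.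
have i2 : mu.-integrable setT (fun x => (B * gauss_wave a c b x)%:E).
  by under eq_fun do rewrite EFinM; exact: integrableZl.
transitivity (\int[mu]_x (A * expR (- (a * x ^+ 2)) + B * gauss_wave a c b x)%:E)%E.
  by apply: eq_integral => x _; congr EFin; rewrite /gauss_wave; ring.
have i3 : mu.-integrable setT
    (fun x => (A * expR (- (a * x ^+ 2)) + B * gauss_wave a c b x)%:E).
  by under eq_fun do rewrite EFinD; exact: integrableD.
rewrite -[LHS]fineK; last exact: integrable_fin_num.
congr EFin; rewrite -[LHS]/(\int[mu]_x _) RintegralD// !RintegralZl//.
rewrite gauss_fourier// /Rintegral Eg/=; ring.
Qed.

(** Induction on the dimension: integrating out all coordinates but one leaves the
remaining one in the phase of the cosine. The weight 1 + cos is nonnegative, so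
that Tonelli's theorem suffices throughout; the pure cosine is recovered by
subtraction, as c = pi / 2 and b = 0 give the weight 1. *)
Lemma gauss_fourier_tuple n a (b : n.-tuple R) c : 0 < a ->
  (\int[lebesgue_tuple R n]_x
     (expR (- (a * sqnorm x)) * (1 + cos (dot b x + c)))%:E =
   (Num.sqrt (pi / a) ^+ n * (1 + expR (- (sqnorm b / (4 * a))) * cos c))%:E)%E.
Proof.
move=> a0; elim: n b c => [|n IH] b c.
  rewrite /= integral_dirac//=.
    rewrite /sqnorm /dot !big_ord0 mulr0 mul0r oppr0 add0r expR0 diracT mul1e.
    by rewrite expr0 !mul1r.
  apply/measurable_EFinP; exact: measurable_gauss_tuple.
rewrite ge0_integral_tcons; last 2 first.
- apply/measurable_EFinP; exact: measurable_gauss_tuple.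
- by move=> x; rewrite lee_fin mulr_ge0 ?expR_ge0//; have := cos_geN1 (dot b x + c); lra.
pose b' := [tuple of behead b].
pose P := Num.sqrt (pi / a) ^+ n.
transitivity (\int[mu]_x (expR (- (a * x ^+ 2)) * (P +
   (P * expR (- (sqnorm b' / (4 * a)))) * cos (thead b * x + c)))%:E)%E.
  apply: eq_integral => x _.
  rewrite [RHS](_ : _ = (expR (- (a * x ^+ 2)))%:E *
      (P * (1 + expR (- (sqnorm b' / (4 * a))) * cos (thead b * x + c)))%:E)%E; last first.
    by rewrite -EFinM; congr EFin; ring.
  rewrite -IH -ge0_integralZl//; last first.
    by apply/measurable_EFinP; exact: measurable_gauss_tuple.
  apply: eq_integral => t _; rewrite -EFinM; congr EFin.
  rewrite sqnorm_tcons dot_tcons [a * _]mulrDr opprD expRD -mulrA.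
  by rewrite [thead b * x + _]addrC -[in LHS]addrA.
rewrite gauss_fourier_affine//; congr EFin.
have -> : sqnorm b = (thead b) ^+ 2 + sqnorm b'.
  by rewrite -sqnorm_tcons; congr sqnorm; rewrite /tcons/= -tuple_eta.
rewrite [(thead b ^+ 2 + _) / _]mulrDl opprD expRD [_ ^+ n.+1]exprS /P; ring.
Qed.

End tuple_integral.

(** * The Fourier transform of the Matern kernel *)

Section matern_transform.
Context {R : realType} (d : nat).
Notation mu := (@lebesgue_measure R).
Notation mud := (lebesgue_tuple R d).
Variables (nu A : R).
Hypotheses (nu0 : 0 < nu) (A0 : 0 < A).

Definition mixture (x : d.-tuple R) : R := \int[mu]_s gig nu 1 (A * sqnorm x) s.

Let p : R := nu + d%:R / 2.
Let p0 : 0 < p.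
Proof. by rewrite /p ltr_wpDr// divr_ge0. Qed.

Let W : R := Num.sqrt (pi / A) ^+ d * Gamma p.

Lemma sqnorm_ge0 n (x : n.-tuple R) : 0 <= sqnorm x.
Proof. by apply: sumr_ge0 => i _; exact: sqr_ge0. Qed.

Lemma mixtureEFin (x : d.-tuple R) :
  ((mixture x)%:E = \int[mu]_s (gig nu 1 (A * sqnorm x) s)%:E)%E.
Proof.
rewrite /mixture /Rintegral fineK// ge0_fin_numE; last first.
  by apply: integral_ge0 => s _; rewrite lee_fin gig_ge0.
apply: le_lt_trans (integral_gig_fin nu0); apply: ge0_le_integral => //.
- by move=> s _; rewrite lee_fin gig_ge0.
- by apply/measurable_EFinP; exact: measurable_gig.
- by apply/measurable_EFinP; exact: measurable_gig.
- move=> s _; rewrite lee_fin ler_expR mul0r subr0 lerBlDr lerDl.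
  by rewrite !mulr_ge0 ?expR_ge0 ?sqnorm_ge0 ?(ltW A0).
Qed.

Lemma mixture_ge0 x : 0 <= mixture x.
Proof. by apply: Rintegral_ge0 => s _; exact: gig_ge0. Qed.

Lemma measurable_gig_pair : measurable_fun setT
  (fun z : d.-tuple (measurableTypeR R) * measurableTypeR R =>
    gig nu 1 (A * sqnorm z.1) z.2).
Proof.
have m1 : measurable_fun setT
    (fun z : d.-tuple (measurableTypeR R) * measurableTypeR R => sqnorm z.1).
  by apply: measurableT_comp => //; exact: measurable_sqnorm.
have m2 : measurable_fun setT
  (fun z : d.-tuple (measurableTypeR R) * measurableTypeR R => (z.2 : R)).
  exact: measurable_snd.
apply: measurableT_comp => //; apply: measurable_funB.
  apply: measurable_funB; first exact: measurable_funM.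
  by apply: measurable_funM => //; exact: measurableT_comp.
apply: measurable_funM; first exact: measurable_funM.
by apply: measurableT_comp => //; exact: measurableT_comp.
Qed.

Lemma measurable_mixture :
  measurable_fun setT (fun x : d.-tuple (measurableTypeR R) => mixture x).
Proof.
apply/measurable_EFinP.
rewrite (_ : _ \o _ = fun x => (\int[mu]_s (gig nu 1 (A * sqnorm x) s)%:E)%E); last first.
  by apply/funext => x /=; rewrite -mixtureEFin.
have := @measurable_fun_fubini_tonelli_F _ _ _ _ R mu
  (fun z : d.-tuple (measurableTypeR R) * measurableTypeR R =>
    (gig nu 1 (A * sqnorm z.1) z.2)%:E).
apply; first by apply/measurable_EFinP; exact: measurable_gig_pair.
by move=> z; rewrite lee_fin gig_ge0.
Qed.

(** For fixed s the integral over x is a Gaussian one with parameter A e^{- s}; its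
value involves e^{d s / 2} and exp(- |b|^2 e^s / 4 A), which merely shift the
parameters of the gamma integral over s. The sign of cos c is restricted so as to
keep that second integrand nonnegative; c = 0 and c = pi / 2 are the cases of
interest. *)
Lemma integral_mixture (b : d.-tuple R) c : 0 <= cos c ->
  (\int[mud]_x (mixture x * (1 + cos (dot b x + c)))%:E =
   (W * (1 + (1 + sqnorm b / (4 * A)) `^ (- p) * cos c))%:E)%E.
Proof.
move=> c0.
have cos1 y : 0 <= 1 + cos y :> R by have := cos_geN1 y; lra.
pose f (z : d.-tuple (measurableTypeR R) * measurableTypeR R) :=
  (gig nu 1 (A * sqnorm z.1) z.2 * (1 + cos (dot b z.1 + c)))%:E.
have mf : measurable_fun setT f.
  apply/measurable_EFinP; apply: measurable_funM; first exact: measurable_gig_pair.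
  apply: measurable_funD => //; apply: (measurableT_comp measurable_cos).
  apply: measurable_funD => //.
  by apply: (measurableT_comp (measurable_dot b)); exact: measurable_fst.
have f0 z : (0 <= f z)%E by rewrite lee_fin mulr_ge0// gig_ge0.
transitivity (\int[mud]_x \int[mu]_s f (x, s))%E.
  apply: eq_integral => x _; rewrite mulrC EFinM mixtureEFin -ge0_integralZl//.
  - by apply: eq_integral => s _; rewrite -EFinM mulrC.
  - by apply/measurable_EFinP; exact: measurable_gig.
  - by move=> s _; rewrite lee_fin gig_ge0.
rewrite fubini_tonelli//.
have B0 : 0 < 1 + sqnorm b / (4 * A).
  by rewrite ltr_pwDl// divr_ge0 ?sqnorm_ge0// mulr_ge0// ltW.
transitivity (\int[mu]_s ((Num.sqrt (pi / A) ^+ d)%:E * ((gig p 1 0 s)%:E +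
   (cos c)%:E * (gig p (1 + sqnorm b / (4 * A)) 0 s)%:E)))%E.
  apply: eq_integral => s _.
  have As : 0 < A * expR (- s) by rewrite mulr_gt0// expR_gt0.
  rewrite (_ : (fun x => f (x, s)) = (fun x => (gig nu 1 0 s)%:E *
     (expR (- (A * expR (- s) * sqnorm x)) * (1 + cos (dot b x + c)))%:E)%E); last first.
    apply/funext => x; rewrite -EFinM mulrA /f /gig /= mul0r subr0 -expRD.
    by congr (expR _ * _)%:E; ring.
  rewrite ge0_integralZl//; last 2 first.
  - by apply/measurable_EFinP; exact: measurable_gauss_tuple.
  - by rewrite lee_fin gig_ge0.
  rewrite gauss_fourier_tuple//; congr EFin.
  have -> : pi / (A * expR (- s)) = pi / A * (expR (s / 2)) ^+ 2.
    rewrite -expRM_natr mulfVK// expRN; field; rewrite !gt_eqF//= ?expR_gt0//.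
  rewrite sqrtrM ?divr_ge0 ?pi_ge0 ?(ltW A0)// sqrtr_sqr ger0_norm ?expR_ge0//.
  rewrite exprMn -expRM_natr [LHS]mulrCA -!mulrA; congr (_ * _).
  rewrite mulrDr mulr1 mulrDr mulrCA; congr (_ + _).
    by rewrite /gig -expRD; congr expR; rewrite /p; field.
  have -> : sqnorm b / (4 * (A * expR (- s))) = sqnorm b / (4 * A) * expR s.
    by rewrite expRN; field; rewrite !gt_eqF//= ?expR_gt0.
  have -> : gig p (1 + sqnorm b / (4 * A)) 0 s = gig nu 1 0 s *
      expR (s * (2^-1 * d%:R)) * expR (- (sqnorm b / (4 * A) * expR s)).
    by rewrite /gig -!expRD; congr expR; rewrite /p; field; rewrite gt_eqF.
  by ring.
have m1 q e : measurable_fun setT (fun s => (gig q e 0 s)%:E).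
  by apply/measurable_EFinP; exact: measurable_gig.
rewrite ge0_integralZl//; last 2 first.
- apply/measurable_EFinP; apply: measurable_funD; first exact: measurable_gig.
  by apply: measurable_funM => //; exact: measurable_gig.
- by move=> s _; rewrite adde_ge0 ?mule_ge0 ?lee_fin ?gig_ge0.
rewrite ge0_integralD//; last 4 first.
- by move=> s _; rewrite lee_fin gig_ge0.
- by apply/measurable_EFinP; exact: measurable_gig.
- by move=> s _; rewrite mule_ge0 ?lee_fin ?gig_ge0.
- by apply/measurable_EFinP; apply: measurable_funM => //; exact: measurable_gig.
rewrite ge0_integralZl//; last 2 first.
- by apply/measurable_EFinP; exact: measurable_gig.
- by move=> s _; rewrite lee_fin gig_ge0.
rewrite GammaEFin// integral_gig_scale//; congr EFin.
by rewrite /W; ring.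
Qed.

Lemma integral_mixture1 : (\int[mud]_x (mixture x)%:E = W%:E)%E.
Proof.
have := @integral_mixture [tuple 0 | i < d] (pi / 2).
rewrite cos_pihalf mulr0 addr0 mulr1 => <-//.
apply: eq_integral => x _; rewrite /dot big1 => [|i _].
  by rewrite add0r cos_pihalf addr0 mulr1.
by rewrite tnth_mktuple mul0r.
Qed.

Lemma integrable_mixture :
  mud.-integrable setT (fun x => (mixture x)%:E).
Proof.
apply/integrableP; split; first by apply/measurable_EFinP; exact: measurable_mixture.
under eq_integral do rewrite gee0_abs ?lee_fin ?mixture_ge0//.
by rewrite integral_mixture1 ltry.
Qed.

Lemma integrable_mixture_cos (b : d.-tuple R) c :
  mud.-integrable setT (fun x => (mixture x * cos (dot b x + c))%:E).
Proof.
apply: le_integrable integrable_mixture => //.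
  apply/measurable_EFinP; apply: measurable_funM; first exact: measurable_mixture.
  apply: (measurableT_comp measurable_cos).
  by apply: measurable_funD => //; exact: measurable_dot.
move=> x _; rewrite lee_fin normrM ler_piMr//.
by rewrite ler_norml cos_geN1 cos_le1.
Qed.

Lemma Rintegral_mixture_cos (b : d.-tuple R) c : 0 <= cos c ->
  \int[mud]_x (mixture x * cos (dot b x + c)) =
  W * ((1 + sqnorm b / (4 * A)) `^ (- p) * cos c).
Proof.
move=> c0; have H := integral_mixture b c0.
have i2 := integrable_mixture_cos b c.
have : \int[mud]_x (mixture x * (1 + cos (dot b x + c))) =
    W * (1 + (1 + sqnorm b / (4 * A)) `^ (- p) * cos c).
  by rewrite /Rintegral H.
under eq_Rintegral do rewrite mulrDr mulr1.
rewrite RintegralD//; last exact: integrable_mixture.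
rewrite [X in X + _]/Rintegral integral_mixture1/= mulrDr mulr1.
by move/addrI.
Qed.

End matern_transform.

Section matern_hat.
Context {R : realType} (d : nat).

Lemma sqr_enorm n (x : n.-tuple R) : enorm x ^+ 2 = sqnorm x.
Proof. by rewrite /enorm sqr_sqrtr//; exact: sqnorm_ge0. Qed.

Lemma maternE (sigma2 lambda nu : R) (x : d.-tuple R) : 0 < lambda -> 0 < nu ->
  matern sigma2 lambda nu x =
  sigma2 / Gamma nu * mixture nu (nu / (2 * lambda ^+ 2)) x.
Proof.
move=> l0 n0; rewrite /matern matern_kappaE//; last first.
  by rewrite divr_ge0 ?sqrtr_ge0// ltW.
rewrite /mixture exprMn sqr_enorm; congr (_ * _).
by apply: eq_Rintegral => s _; congr gig; field; rewrite gt_eqF.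
Qed.

(** The phase c = 0 gives the real part and c = pi / 2 the imaginary part, since
sin (- y) = cos (y + pi / 2); the factor cos c makes the latter vanish. *)
Lemma matern_hatE (sigma2 lambda nu : R) (xi : d.-tuple R) :
  0 < lambda -> 0 < nu ->
  matern_hat sigma2 lambda nu xi =
  (sigma2 / Gamma nu * (Num.sqrt (2 * pi * lambda ^+ 2 / nu) ^+ d *
    Gamma (nu + d%:R / 2) *
    (1 + 2 * pi ^+ 2 * lambda ^+ 2 * sqnorm xi / nu) `^ (- (nu + d%:R / 2))))%:C.
Proof.
move=> l0 n0; have A0 : 0 < nu / (2 * lambda ^+ 2).
  by rewrite divr_gt0// mulr_gt0// exprn_gt0.
pose b : d.-tuple R := [tuple 2 * pi * tnth xi i | i < d].
have bE x : dot b x = 2 * pi * dot xi x.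
  by rewrite /dot mulr_sumr; apply: eq_bigr => i _; rewrite tnth_mktuple mulrA.
have sqb : sqnorm b = 4 * pi ^+ 2 * sqnorm xi.
  rewrite /sqnorm mulr_sumr; apply: eq_bigr => i _; rewrite tnth_mktuple; ring.
have i2 c := integrable_mixture_cos n0 A0 b c.
rewrite /matern_hat /fourier /cintegral; congr Complex.
- transitivity (\int[lebesgue_tuple R d]_x (sigma2 / Gamma nu *
    (mixture nu (nu / (2 * lambda ^+ 2)) x * cos (dot b x + 0)))).
    apply: eq_Rintegral => x _; rewrite /= mul0r subr0 cosN maternE// addr0 bE [RHS]mulrA//.
  rewrite RintegralZl; [|exact: measurableT|exact: i2].
  rewrite (@Rintegral_mixture_cos R d nu _ n0 A0 b 0) ?cos0// mulr1.
  have -> : pi / (nu / (2 * lambda ^+ 2)) = 2 * pi * lambda ^+ 2 / nu.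
    by field; rewrite !gt_eqF.
  rewrite sqb; congr (_ * (_ * _ `^ _)).
  by field; rewrite !gt_eqF.
- transitivity (\int[lebesgue_tuple R d]_x (sigma2 / Gamma nu *
    (mixture nu (nu / (2 * lambda ^+ 2)) x * cos (dot b x + pi / 2)))).
    apply: eq_Rintegral => x _; rewrite /= mul0r addr0 sinN maternE// cosDpihalf bE [RHS]mulrA//.
  rewrite RintegralZl; [|exact: measurableT|exact: i2].
  by rewrite (@Rintegral_mixture_cos R d nu _ n0 A0 b (pi / 2)) cos_pihalf// !mulr0.
Qed.

End matern_hat.

(** * Growth of the gamma function and lattice points in a ball *)

Section bounds.
Context {R : realType}.
Notation mu := (@lebesgue_measure R).

Lemma sin_le_id (y : R) : 0 <= y -> sin y <= y.
Proof.
move=> y0; have := @MVT_segment R sin cos 0 y y0 (fun x _ => is_derive_sin x).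
case; first by apply: continuous_subspaceT; exact: continuous_sin.
move=> c _; rewrite sin0 !subr0 => ->.
by rewrite ler_piMl// cos_le1.
Qed.

Lemma cos_ge_parabola (x : R) : 0 <= x -> x <= 2 -> 1 - x ^+ 2 / 2 <= cos x.
Proof.
move=> x0 x2; pose y := x / 2.
have y0 : 0 <= y by rewrite divr_ge0.
have cx : cos x = cos y ^+ 2 * 2 - 1.
  by rewrite mulr_natr -cos_mulr2n -mulr_natr mulfVK.
have s0 : 0 <= sin y.
  by apply: sin_ge0_pi; rewrite y0/=; have := pi_ge2 R; rewrite /y; lra.
have : sin y ^+ 2 <= y ^+ 2 by rewrite lerXn2r ?nnegrE// sin_le_id.
have := cos2Dsin2 y.
have -> : x ^+ 2 / 2 = y ^+ 2 * 2 by rewrite /y; field.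
rewrite cx; move: (y ^+ 2) (sin y ^+ 2) (cos y ^+ 2) => u v w; lra.
Qed.

(** The rough estimate cos x >= 1 - x^2 / 2 at 4 / 11, doubled twice, shows
cos (16 / 11) > 0, hence pi > 32 / 11, and (32 / 11)^2 = 1024 / 121 > 8. *)
Lemma sqr_pi_gt8 : 8 < pi ^+ 2 :> R.
Proof.
have sq (a b : R) : 0 <= a -> a <= b -> a ^+ 2 <= b ^+ 2.
  by move=> a0 ab; rewrite lerXn2r ?nnegrE// (le_trans a0).
have dbl (x y : R) : y = x + x -> cos y = 2 * cos x ^+ 2 - 1.
  by move=> ->; rewrite -mulr2n cos_mulr2n mulr_natl.
have h1 : 13 / 14 <= cos (4 / 11) :> R.
  by apply: le_trans (@cos_ge_parabola _ _ _); lra.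
have h2 : 5 / 7 <= cos (8 / 11) :> R.
  rewrite (dbl (4 / 11)); last by lra.
  by have := sq (13 / 14) _ ltac:(lra) h1; lra.
have h3 : 0 < cos (16 / 11) :> R.
  rewrite (dbl (8 / 11)); last by lra.
  by have := sq (5 / 7) _ ltac:(lra) h2; lra.
have h4 : 16 / 11 < pi / 2 :> R.
  by rewrite -ltr_cos ?cos_pihalf// in_itv/=; have := pi_ge2 R; lra.
by have := sq (32 / 11) pi ltac:(lra) ltac:(lra); lra.
Qed.

(** With y = e^t this bounds y^{n / 2} by a multiple of exp(y / 4). The tangent of
e^t at c = ln (2 n) has slope 2 n, so e^t / 4 dominates (n / 2) t up to a
constant. *)
Lemma expR_linear_le (n : nat) : (0 < n)%N ->
  exists2 K : R, 0 < K & forall t, expR (n%:R / 2 * t) <= K * expR (expR t / 4).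
Proof.
move=> n0; have n2 : 0 < 2 * n%:R :> R by rewrite mulr_gt0// ltr0n.
pose c : R := ln (2 * n%:R).
exists (expR (n%:R / 2 * (c - 1))); first exact: expR_gt0.
move=> t; rewrite -expRD ler_expR.
have : 2 * n%:R * (1 + (t - c)) <= expR t.
  have -> : expR t = 2 * n%:R * expR (t - c).
    by rewrite -{1}(@lnK R (2 * n%:R)) ?posrE// -expRD addrC subrK.
  by rewrite ler_wpM2l ?(ltW n2)// expR_ge1Dx.
lra.
Qed.

(** Writing the gamma integrand in u = e^x, the bound
(u / nu)^{n / 2} <= K exp(u / (4 nu)) reduces Gamma(nu + n / 2) to a rescaled
Gamma(nu). The rescaling costs (1 - 1 / (4 nu))^{- nu}, which stays bounded
because - ln (1 - 1 / (4 nu)) <= 1 / (2 nu) as soon as 1 / (4 nu) <= 1 / 2. *)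
Lemma Gamma_ratio_le (n : nat) : (0 < n)%N ->
  exists2 G : R, 0 < G & forall nu, 1 / 2 <= nu ->
    Gamma (nu + n%:R / 2) <= G * nu `^ (n%:R / 2) * Gamma nu.
Proof.
move=> n0; have [K K0 KP] := expR_linear_le n0.
exists (K * expR 1); first by rewrite mulr_gt0// expR_gt0.
move=> nu nu2; have nu0 : 0 < nu by lra.
have p0 : 0 < nu + n%:R / 2 by rewrite ltr_wpDr// divr_ge0.
pose e : R := 1 - (4 * nu)^-1.
have i4 : (4 * nu)^-1 <= 2^-1 by rewrite lef_pV2 ?posrE ?mulr_gt0//; lra.
have i40 : 0 < (4 * nu)^-1 by rewrite invr_gt0 mulr_gt0.
have e0 : 0 < e by rewrite /e; lra.
have M0 : 0 <= K * nu `^ (n%:R / 2) by rewrite mulr_ge0 ?powR_ge0// ltW.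
have : Gamma (nu + n%:R / 2) <= K * nu `^ (n%:R / 2) * (Gamma nu * e `^ (- nu)).
  rewrite -lee_fin -GammaEFin// EFinM -integral_gig_scale// -ge0_integralZl//.
  - apply: ge0_le_integral => //.
    + by move=> x _; rewrite lee_fin gig_ge0.
    + by apply/measurable_EFinP; exact: measurable_gig.
    + by apply/measurable_EFinP; apply: measurable_funM => //; exact: measurable_gig.
    + move=> x _; rewrite lee_fin.
      have := KP (x - ln nu).
      have -> : expR (x - ln nu) / 4 = (4 * nu)^-1 * expR x.
        by rewrite expRD expRN lnK ?posrE//; field; rewrite gt_eqF.
      move=> h.
      have -> : gig (nu + n%:R / 2) 1 0 x =
          expR (n%:R / 2 * (x - ln nu)) * (nu `^ (n%:R / 2) * gig nu 1 0 x).
        by rewrite /gig /powR gt_eqF// -!expRD; congr expR; field.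
      apply: (le_trans (ler_wpM2r _ h)).
        by rewrite mulr_ge0 ?powR_ge0 ?gig_ge0.
      have -> : gig nu e 0 x = expR ((4 * nu)^-1 * expR x) * gig nu 1 0 x.
        by rewrite /gig -expRD; congr expR; rewrite /e; field; rewrite gt_eqF.
      by rewrite le_eqVlt; apply/orP; left; apply/eqP; ring.
  - by apply/measurable_EFinP; exact: measurable_gig.
  - by move=> x _; rewrite lee_fin gig_ge0.
move/le_trans; apply.
have he : e `^ (- nu) <= expR 1.
  rewrite /powR gt_eqF// ler_expR mulNr -mulrN -lnV ?posrE//.
  have le1 : ln e^-1 <= 2 * (4 * nu)^-1.
    rewrite -[X in _ <= X]expRK ler_ln ?posrE ?invr_gt0 ?expR_gt0//.
    apply: (@le_trans _ _ (1 + 2 * (4 * nu)^-1)); last exact: expR_ge1Dx.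
    rewrite -[X in X <= _]mul1r ler_pdivrMr//.
    by rewrite /e; move: ((4 * nu)^-1) i4 i40 => u u1 u2; nra.
  apply: (le_trans (ler_wpM2l (ltW nu0) le1)).
  by rewrite (_ : nu * _ = 2^-1); [lra|field; rewrite gt_eqF].
have := Gamma_gt0 nu0 => G0.
rewrite [X in X <= _](_ : _ = K * nu `^ (n%:R / 2) * Gamma nu * e `^ (- nu)); last by ring.
rewrite [X in _ <= X](_ : _ = K * nu `^ (n%:R / 2) * Gamma nu * expR 1); last by ring.
by rewrite ler_wpM2l// mulr_ge0// ltW.
Qed.

(** The j distinct points k(1), ..., k(j) lie in the ball of radius |k(j)|, hence in
the cube of lattice points with all coordinates at most m = floor |k(j)| in
absolute value, which has (2 m + 1)^d elements. Using the cube instead of the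
ball costs nothing that matters: it has 4 in place of the optimal coefficient
of r^2, and 4 < pi^2 / 2. *)
Lemma enumeration_count d (k : nat -> d.-tuple int) (j : nat) :
  norm_enumeration R k -> (1 <= j)%N ->
  j%:R <= (2 * enorm (intvec R (k j)) + 1) ^+ d.
Proof.
move=> [[_ kinj _] _ kmono] j1; set r := enorm _.
have r0 : 0 <= r by exact: sqrtr_ge0.
pose m := Num.truncn r.
have mr : m%:R <= r by rewrite truncn_le.
have comp i t : (1 <= i <= j)%N -> (`|tnth (k i) t| <= m)%N.
  move=> /andP[i1 ij].
  have h1 : enorm (intvec R (k i)) <= r by exact: kmono.
  have h2 : `|tnth (intvec R (k i)) t| <= enorm (intvec R (k i)).
    rewrite -sqrtr_sqr ler_wsqrtr// (bigD1 t)//= lerDl.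
    by apply: sumr_ge0 => s _; exact: sqr_ge0.
  rewrite /m truncn_ge_nat//.
  apply: le_trans (le_trans h2 h1).
  by rewrite tnth_mktuple -intr_norm -abszE.
(* Shifting the coordinates by m makes them nonnegative and at most 2 m; the
   enumeration starts at index 1, whence i.+1. *)
pose F (i : 'I_j) : {ffun 'I_d -> 'I_(2 * m).+1} :=
  [ffun t => inord (absz (tnth (k i.+1) t + m%:Z))].
have Finj : injective F.
  move=> i i' /ffunP FF; apply: val_inj; apply: succn_inj.
  apply: kinj; rewrite ?inE//.
  apply: eq_from_tnth => t; have := FF t; rewrite !ffunE => /(congr1 val).
  have ci := comp i.+1 t; have ci' := comp i'.+1 t.
  rewrite ltn_ord in ci; rewrite ltn_ord in ci'.
  rewrite /= !inordK; lia.
have := leq_card F Finj; rewrite card_ord card_ffun !card_ord => h.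
apply: (@le_trans _ _ (((2 * m).+1 ^ d)%N)%:R); first by rewrite ler_nat.
rewrite natrX lerXn2r ?nnegrE//; first by rewrite addr_ge0// mulr_ge0.
by rewrite -natr1 natrM lerD2r ler_wpM2l.
Qed.

End bounds.

(** * The decay estimate *)

Section main_bounds.
Context {R : realType}.

Lemma freq_sqnorm d (l : R) (k : d.-tuple int) : 0 < l ->
  sqnorm (freq l k) = enorm (intvec R k) ^+ 2 / (4 * l ^+ 2).
Proof.
move=> l0; rewrite sqr_enorm /sqnorm mulr_suml.
by apply: eq_bigr => i _; rewrite !tnth_mktuple; field; rewrite gt_eqF.
Qed.

(** The excess pi^2 / 2 - 4 > 0 of the quadratic coefficient absorbs the linear
term 4 r, by completing the square. *)
Lemma count_quadratic : exists2 N : R, 1 <= N &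
  forall r, 0 <= r -> (2 * r + 1) ^+ 2 <= N + pi ^+ 2 / 2 * r ^+ 2.
Proof.
have h8 := @sqr_pi_gt8 R.
pose del : R := pi ^+ 2 / 2 - 4.
have d0 : 0 < del by rewrite /del; lra.
exists (1 + 4 / del); first by rewrite lerDl divr_ge0// ltW.
move=> r r0.
have -> : 1 + 4 / del + pi ^+ 2 / 2 * r ^+ 2 =
    (2 * r + 1) ^+ 2 + (del * r - 2) ^+ 2 / del.
  by rewrite /del; field; rewrite gt_eqF// /del in d0 *; lra.
by rewrite lerDl divr_ge0 ?sqr_ge0// ltW.
Qed.

(** Raising to the power p amplifies any constant larger than 1, so the two regimes
nu <= N and N < nu are separated: in the first p is bounded, and in the second
no constant is lost, because nu itself exceeds the lower order term N of
[count_quadratic]. *)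
Lemma decay_bound (d : nat) : (1 <= d)%N ->
  exists2 C : R, 0 < C &
    forall (lambda nu l r J : R), 0 < lambda -> lambda <= 1 -> 1 / 2 <= nu -> 1 <= l ->
      0 <= r -> 0 < J -> J <= (2 * r + 1) ^+ 2 ->
      lambda ^+ d *
        (1 + pi ^+ 2 * lambda ^+ 2 * r ^+ 2 / (2 * nu * l ^+ 2)) `^ (- (nu + d%:R / 2)) <=
      C * (lambda `^ (- (2 * nu)) * (nu * l ^+ 2) `^ (nu + d%:R / 2) *
           J `^ (- (nu + d%:R / 2))).
Proof.
move=> d1; have [N N1 NP] := count_quadratic.
have N0 : 0 < N by lra.
exists ((2 * N) `^ (N + d%:R / 2)); first by rewrite powR_gt0// mulr_gt0.
move=> lambda nu l r J l0 l1 nu2 ell1 r0 J0 Jr.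
have nu0 : 0 < nu by lra.
have ell0 : 0 < l by lra.
set p := nu + d%:R / 2.
have p0 : 0 < p by rewrite /p ltr_wpDr// divr_ge0.
set B := _ / (2 * nu * l ^+ 2).
have B0 : 0 <= B.
  by rewrite /B divr_ge0 -?exprMn ?sqr_ge0// mulr_ge0 ?sqr_ge0// mulr_ge0// ltW.
have nl0 : 0 < nu * l ^+ 2 by rewrite mulr_gt0// exprn_gt0.
have B10 : 0 < 1 + B by lra.
have lsq0 : 0 < lambda ^+ 2 by rewrite exprn_gt0.
pose Y := nu * l ^+ 2 * (1 + B).
have Y0 : 0 < Y by rewrite mulr_gt0.
have YE : Y = nu * l ^+ 2 + pi ^+ 2 / 2 * r ^+ 2 * lambda ^+ 2.
  by rewrite /Y /B; field; rewrite !gt_eqF.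
have lsq1 : lambda ^+ 2 <= 1 by rewrite expr_le1// ltW.
have ellsq1 : 1 <= l ^+ 2 by rewrite expr_ge1// ltW.
(* The quotient lambda^2 J / Y is at most 2 N if nu <= N and at most 1 otherwise. *)
have key : (lambda ^+ 2 * J) `^ p <= (2 * N) `^ (N + d%:R / 2) * Y `^ p.
  have X0 : 0 <= lambda ^+ 2 * J by rewrite mulr_ge0// ltW.
  have XN : lambda ^+ 2 * J <= lambda ^+ 2 * N + pi ^+ 2 / 2 * r ^+ 2 * lambda ^+ 2.
    by rewrite [X in _ + X]mulrC -mulrDr ler_wpM2l ?(ltW lsq0)// (le_trans Jr)// NP.
  have pr0 : 0 <= pi ^+ 2 / 2 * r ^+ 2 * lambda ^+ 2.
    by rewrite mulr_ge0 ?sqr_ge0// mulr_ge0 ?sqr_ge0// divr_ge0 ?sqr_ge0.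
  have [nN|Nnu] := leP nu N.
    have h : lambda ^+ 2 * J <= 2 * N * Y.
      apply: (le_trans XN); rewrite YE mulrDr; apply: lerD.
        apply: (@le_trans _ _ N); first by rewrite ler_piMl// ltW.
        have : nu <= nu * l ^+ 2 by rewrite ler_peMr// ltW.
        nra.
      by rewrite ler_peMl//; lra.
    apply: (le_trans (ge0_ler_powR (ltW p0) _ _ h)); rewrite ?nnegrE//.
      by rewrite mulr_ge0 ?(ltW Y0)//; lra.
    have N20 : 0 <= 2 * N by lra.
    rewrite (@powRM _ (2 * N) Y)//; last exact: ltW.
    rewrite ler_wpM2r ?powR_ge0//.
    by apply: ler_powR; [lra|rewrite /p; lra].
  have h : lambda ^+ 2 * J <= Y.
    apply: (le_trans XN); rewrite YE lerD2r.
    apply: (@le_trans _ _ N); first by rewrite ler_piMl// ltW.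
    by apply: (le_trans (ltW Nnu)); rewrite ler_peMr// ltW.
  apply: (@le_trans _ _ (Y `^ p)).
    by apply: ge0_ler_powR => //; rewrite ?nnegrE// ltW.
  rewrite ler_peMl ?powR_ge0// -[X in X <= _](powRr0 (2 * N)).
  by apply: ler_powR; [lra|rewrite addr_ge0 ?divr_ge0// ltW].
have lamE : lambda ^+ d = lambda `^ (- (2 * nu)) * (lambda ^+ 2) `^ p.
  rewrite -!powR_mulrn ?(ltW l0)// -powRrM -powRD; last by rewrite (gt_eqF l0)/= implybT.
  by congr (_ `^ _); rewrite /p; field.
rewrite lamE !powRN -!mulrA [X in _ <= X]mulrCA ler_wpM2l ?invr_ge0 ?powR_ge0//.
rewrite ler_pdivrMr ?powR_gt0//.
rewrite [X in _ <= X](_ : _ = (2 * N) `^ (N + d%:R / 2) *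
  ((nu * l ^+ 2) `^ p * (1 + B) `^ p) / J `^ p); last by ring.
by rewrite ler_pdivlMr ?powR_gt0// -!powRM// ltW.
Qed.

End main_bounds.

Theorem theorem3p4 (R : realType) (d : nat) (hd : (1 <= d)%N)
    (sigma2 : R) (hsigma2 : 0 < sigma2) :
  exists2 C : R, 0 < C &
    forall (lambda nu l : R) (k : nat -> d.-tuple int),
      0 < lambda -> lambda <= 1 -> 1 / 2 <= nu -> 1 <= l ->
      norm_enumeration R k ->
      forall j : nat, (1 <= j)%N ->
        0 < matern_hat sigma2 lambda nu (freq l (k j)) /\
        matern_hat sigma2 lambda nu (freq l (k j)) <=
          (C * (lambda `^ (- (2 * nu)) * (nu * l ^+ 2) `^ (nu + d%:R / 2) *
                j%:R `^ (- (1 + 2 * nu / d%:R))))%:C.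
Proof.
have [G G0 GP] := @Gamma_ratio_le R d hd.
have [D D0 DP] := @decay_bound R d hd.
have d0 : 0 < d%:R :> R by rewrite ltr0n.
have tp0 : 0 < 2 * pi :> R by rewrite mulr_gt0// pi_gt0.
pose S : R := sigma2 * G * Num.sqrt (2 * pi) ^+ d.
have S0 : 0 < S by rewrite !mulr_gt0// exprn_gt0// sqrtr_gt0.
exists (S * D); first by rewrite mulr_gt0.
move=> lambda nu l k l0 l1 nu2 ell1 kenum j j1.
have nu0 : 0 < nu by lra.
have ell0 : 0 < l by lra.
have p0 : 0 < nu + d%:R / 2 by rewrite ltr_wpDr// divr_ge0.
have jR : 0 < j%:R :> R by rewrite ltr0n.
have Gnu := Gamma_gt0 nu0; have Gp := Gamma_gt0 p0.
pose r : R := enorm (intvec R (k j)).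
have r0 : 0 <= r by exact: sqrtr_ge0.
rewrite matern_hatE// freq_sqnorm// -/r.
have -> : 1 + 2 * pi ^+ 2 * lambda ^+ 2 * (r ^+ 2 / (4 * l ^+ 2)) / nu =
    1 + pi ^+ 2 * lambda ^+ 2 * r ^+ 2 / (2 * nu * l ^+ 2).
  by congr (1 + _); field; rewrite !gt_eqF.
set B := 1 + _ / (2 * nu * l ^+ 2).
have B0 : 0 < B.
  by rewrite ltr_pwDl// divr_ge0 -?exprMn ?sqr_ge0// mulr_ge0 ?sqr_ge0// mulr_ge0// ltW.
have s0 : 0 < 2 * pi * lambda ^+ 2 / nu by rewrite divr_gt0// mulr_gt0// exprn_gt0.
split.
  rewrite ltcR mulr_gt0 ?divr_gt0// !mulr_gt0 ?powR_gt0// exprn_gt0//.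
  by rewrite sqrtr_gt0.
rewrite lecR.
have sE : Num.sqrt (2 * pi * lambda ^+ 2 / nu) ^+ d * nu `^ (d%:R / 2) =
    Num.sqrt (2 * pi) ^+ d * lambda ^+ d.
  have -> : nu `^ (d%:R / 2) = Num.sqrt nu ^+ d.
    by rewrite -powR12_sqrt ?(ltW nu0)// -powR_mulrn ?powR_ge0// -powRrM mulrC.
  rewrite -!exprMn -sqrtrM ?(ltW s0)// mulfVK ?gt_eqF//.
  by rewrite sqrtrM ?(ltW tp0)// sqrtr_sqr ger0_norm// ltW.
(* J stands for j^{2 / d}, which turns the exponent 1 + 2 nu / d into
   nu + d / 2. *)
pose J : R := j%:R `^ (2 / d%:R).
have J0 : 0 < J by rewrite powR_gt0.
have JE : j%:R `^ (- (1 + 2 * nu / d%:R)) = J `^ (- (nu + d%:R / 2)).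
  by rewrite /J -powRrM; congr (_ `^ _); field; rewrite gt_eqF.
have Jr : J <= (2 * r + 1) ^+ 2.
  have q0 : 0 <= 2 * r + 1 by rewrite addr_ge0// mulr_ge0.
  have -> : (2 * r + 1) ^+ 2 = ((2 * r + 1) ^+ d) `^ (2 / d%:R).
    rewrite -!powR_mulrn// -powRrM; congr (_ `^ _).
    by rewrite mulrCA divff ?mulr1// gt_eqF.
  apply: ge0_ler_powR; rewrite ?nnegrE ?exprn_ge0 ?divr_ge0//.
  exact: enumeration_count.
have dec := DP lambda nu l r J l0 l1 nu2 ell1 r0 J0 Jr.
rewrite JE -[X in _ <= X]mulrA.
apply: le_trans (ler_wpM2l (ltW S0) dec).
have sq0 : 0 <= Num.sqrt (2 * pi * lambda ^+ 2 / nu) ^+ d * B `^ (- (nu + d%:R / 2)).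
  by rewrite mulr_ge0 ?powR_ge0 ?exprn_ge0 ?sqrtr_ge0.
have sG : 0 <= sigma2 / Gamma nu by rewrite divr_ge0// ltW.
have := ler_wpM2l (mulr_ge0 sG sq0) (GP nu nu2).
have -> : sigma2 / Gamma nu *
  (Num.sqrt (2 * pi * lambda ^+ 2 / nu) ^+ d * B `^ (- (nu + d%:R / 2))) *
  Gamma (nu + d%:R / 2) =
  sigma2 / Gamma nu * (Num.sqrt (2 * pi * lambda ^+ 2 / nu) ^+ d *
    Gamma (nu + d%:R / 2) * B `^ (- (nu + d%:R / 2))) by ring.
move/le_trans; apply.
rewrite [X in X <= _](_ : _ = sigma2 * G *
  (Num.sqrt (2 * pi * lambda ^+ 2 / nu) ^+ d * nu `^ (d%:R / 2)) *
  B `^ (- (nu + d%:R / 2)) * (Gamma nu / Gamma nu)); last by ring.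
rewrite divff ?gt_eqF// mulr1 sE le_eqVlt; apply/orP; left; apply/eqP.
by rewrite /S; ring.
Qed.
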